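(* Let $0<\alpha<1$, $\varepsilon>0$, $M>0$, $S\ge 0$, and let $0=t_0<t_1<\dots<t_N=T$ be an arbitrary (possibly non-uniform) temporal grid with steps $\tau_k=t_k-t_{k-1}$. Let $\phi^0$ be given and set $r^{-\frac12}=(\phi^0)^2-1-S$. Let $(\phi^{n+1},\mu^{n+\frac12},r^{n+\frac12})$, $0\le n\le N-1$, satisfy the $L1^+$ linear relaxation scheme for the time-fractional Cahn-Hilliard equation on $\Omega$, with periodic or homogeneous Neumann boundary conditions: for $0\le n\le N-1$, $$\partial_\tau^\alpha \phi^{n+\frac12} = M\Delta\mu^{n+\frac12},$$ $$\mu^{n+\frac12} = -\varepsilon^2\Delta\phi^{n+\frac12}+\left(r^{n+\frac12}+S\right)\phi^{n+\frac12},$$ $$\frac{r^{n+\frac12}+r^{n-\frac12}}{2}=\left(\phi^n\right)^2-1-S,$$ where $\phi^{n+\frac12}=\frac{\phi^{n+1}+\phi^n}{2}$ and $\partial_\tau^\alpha\phi^{n+\frac12}$ is the $L1^+$ discrete Caputo derivative. Then for every $0\le n\le N-1$, $$\tilde E\left(\phi^{n+1},r^{n+\frac12}\right)\le \tilde E\left(\phi^0,r^{-\frac12}\right)=E\left(\phi^0\right),$$ where $$\tilde E(\phi^{n+1},r^{n+\frac12})=\int_\Omega\left(\frac{\varepsilon^2}{2}|\nabla\phi^{n+1}|^2+\frac12\left(r^{n+\frac12}+S\right)\left((\phi^{n+1})^2-1-S\right)-\frac14\left(r^{n+\frac12}\right)^2\right)d\mathbf{x}+\frac{S^2}{4}|\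Omega|.$$
   Context: $\Omega$ is a bounded spatial domain (a box in the periodic case) with volume $|\Omega|$. Time is discretized and space is left continuous: $\phi^n$, $\mu^{n+\frac12}$, $r^{n+\frac12}$ are real-valued functions on $\Omega$, assumed regular enough for the scheme, the integrals and the integrations by parts to make sense, and satisfying either periodic boundary conditions or homogeneous Neumann boundary conditions ($\partial_{\mathbf n}\phi^n=\partial_{\mathbf n}\mu^{n+\frac12}=0$ on $\partial\Omega$). The functions $\mu^{n+\frac12}$ and $r^{n+\frac12}$ are unknowns at the midpoint $t_{n+\frac12}$; $r^{n+\frac12}$ is a staggered-grid unknown determined by the third equation of the scheme, not an average. The $L1^+$ discrete Caputo derivative: for $n\ge1$, $$\partial_\tau^\alpha u^{n-\frac12}=(\partial_\tau^\alpha u)^{n-\frac12}:=\sum_{k=1}^n b^{(n)}_{n-k}\,\nabla_\tau u^k,\qquad \nabla_\tau u^k=u^k-u^{k-1},$$ $$b^{(n)}_{n-k}=\frac{1}{\Gamma(1-\alpha)\,\tau_n\tau_k}\int_{t_{n-1}}^{t_n}\int_{t_{k-1}}^{\min\{t_k,t\}}(t-s)^{-\alpha}\,ds\,dt,$$ with $\Gamma$ the gamma function; $\partial_\tau^\alpha\phi^{n+\frac12}$ is this expression with $n$ replaced by $n+1$ and $u=\phi$. The original free energy is $E(\phi)=\int_\Omega\left(\frac{\varepsilon^2}{2}|\nabla\phi|^2+\frac14(\phi^2-1)^2\right)d\mathbf{x}$. The modified energy at the initial level, $\tilde E(\phi^0,r^{-\frac12})$, is given by the same formula as $\tilde E(\phi^{n+1},r^{n+\frac12})$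 with $(\phi^{n+1},r^{n+\frac12})$ replaced by $(\phi^0,r^{-\frac12})$. *)

(* Defs.v *)
From HB Require Import structures.
From mathcomp Require Import all_boot all_order all_algebra.
From mathcomp Require Import all_classical all_reals all_analysis.
Set Implicit Arguments.
Unset Strict Implicit.
Unset Printing Implicit Defensive.
Import Order.TTheory GRing.Theory Num.Theory.
Import numFieldNormedType.Exports.
Local Open Scope classical_set_scope.
Local Open Scope ring_scope.

(* R^d is 'rV[R]_d, with the sigma-algebra generated by the coordinates, that
   is, the Borel sigma-algebra. *)
Section measurable_rV.
Variables (R : realType) (d : nat).

Let coord (i : 'I_d) (x : 'rV[R]_d) : measurableTypeR R := x 0 i.

Let rV_set0 : g_sigma_preimage coord set0.
Proof. exact: sigma_algebra0. Qed.

Let rV_setC A : g_sigma_preimage coord A -> g_sigma_preimage coord (~` A).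
Proof. exact: sigma_algebraC. Qed.

Let rV_bigcup (F : (set 'rV[R]_d)^nat) :
  (forall i, g_sigma_preimage coord (F i)) ->
  g_sigma_preimage coord (\bigcup_i F i).
Proof. exact: sigma_algebra_bigcup. Qed.

HB.instance Definition _ := @isMeasurable.Build
  (measure_tuple_display (R.-ocitv.-measurable).-sigma)
  'rV[R]_d (g_sigma_preimage coord) rV_set0 rV_setC rV_bigcup.

Lemma measurable_coord (i : 'I_d) :
  measurable_fun setT (fun x : 'rV[R]_d => x 0 i : measurableTypeR R).
Proof.
move=> _ Y mY; rewrite setTI; apply: sub_sigma_algebra => /=.
rewrite -bigcup_seq/=; exists i => /=; first by rewrite mem_index_enum.
by exists Y => //; rewrite setTI.
Qed.

Lemma measurable_fun_rV d1 (T : measurableType d1) (f : T -> 'rV[R]_d) :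
  (forall i, measurable_fun setT (fun x => f x 0 i : measurableTypeR R)) ->
  measurable_fun setT f.
Proof.
move=> mf _ Y mY; rewrite setTI; move: Y mY.
pose G : set (set 'rV[R]_d) := [set Y | measurable (f @^-1` Y)].
suff: g_sigma_preimage coord `<=` G by move=> sub Y /sub.
apply: smallest_sub.
  split => //=; rewrite /G/=.
  - by rewrite preimage_set0.
  - by move=> A mA; rewrite setTD preimage_setC; exact: measurableC.
  - by move=> F mF; rewrite preimage_bigcup; exact: bigcupT_measurable.
move=> Y; rewrite -bigcup_seq => -[i _ [B mB <-]]; rewrite /G/= setTI.
by rewrite -[X in measurable X]setTI; exact: mf.
Qed.

End measurable_rV.

Section Lebesgue.
Variable R : realType.

Definition rV_cons d (p : 'rV[R]_d * measurableTypeR R) : 'rV[R]_d.+1 :=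
  \row_(i < d.+1) oapp (p.1 0) p.2 (unlift ord0 i).

Lemma measurable_rV_cons d : measurable_fun setT (@rV_cons d).
Proof.
apply: measurable_fun_rV => i; case: (unliftP ord0 i) => [j|] ->.
  rewrite (_ : (fun _ => _) =
      (fun x : 'rV[R]_d => x 0 j : measurableTypeR R) \o fst); last first.
    by apply/funext => p /=; rewrite mxE liftK.
  by apply: measurableT_comp => //; exact: measurable_coord.
rewrite (_ : (fun _ => _) = snd) //.
by apply/funext => p /=; rewrite mxE unlift_none.
Qed.

Section leb_succ.
Variables (n : nat) (m : {measure set 'rV[R]_n -> \bar R}).

Definition leb_succ : set 'rV[R]_n.+1 -> \bar R :=
  pushforward (m \x @lebesgue_measure R)%E (@rV_cons n).

Let leb_succ0 : leb_succ set0 = 0%E.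
Proof. by rewrite /leb_succ /pushforward preimage_set0 measure0. Qed.

Let leb_succ_ge0 A : (0 <= leb_succ A)%E.
Proof. by rewrite /leb_succ /pushforward measure_ge0. Qed.

Let leb_succ_sigma_additive : semi_sigma_additive leb_succ.
Proof.
move=> F mF tF mUF; rewrite /leb_succ /pushforward preimage_bigcup.
have mG i : measurable (@rV_cons n @^-1` F i).
  by rewrite -[X in measurable X]setTI; exact: measurable_rV_cons.
apply: measure_semi_sigma_additive => //; last exact: bigcupT_measurable.
apply/trivIsetP => i j _ _ ij; rewrite -preimage_setI.
by move/trivIsetP : tF => /(_ _ _ _ _ ij) -> //; rewrite preimage_set0.
Qed.

HB.instance Definition _ := isMeasure.Build _ _ _
  leb_succ leb_succ0 leb_succ_ge0 leb_succ_sigma_additive.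

End leb_succ.

(* d-dimensional Lebesgue measure, as an iterated product measure *)
Fixpoint leb (d : nat) : {measure set 'rV[R]_d -> \bar R} :=
  if d is n.+1 then leb_succ (leb n) else dirac (0 : 'rV[R]_0).

End Lebesgue.

Section Calculus.
Variables (R : realType) (d : nat).
Implicit Types (f : 'rV[R]_d -> R) (U Omega : set 'rV[R]_d) (x : 'rV[R]_d).

Definition partial (i : 'I_d) f x : R := 'D_(delta_mx 0 i) f x.

Definition grad_normsq f x : R := \sum_(i < d) partial i f x ^+ 2.

Definition laplacian f x : R := \sum_(i < d) partial i (partial i f) x.

(* Both are meant for open U. *)
Definition C1_on U f : Prop := forall x, U x ->
  {for x, continuous f} /\
  forall i, derivable f x (delta_mx 0 i) /\ {for x, continuous (partial i f)}.

Definition C2_on U f : Prop :=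
  C1_on U f /\ forall i, C1_on U (partial i f).

Definition boundary Omega : set 'rV[R]_d := closure Omega `\` interior Omega.

Definition bounded_domain Omega : Prop :=
  [/\ open Omega, connected Omega, Omega !=set0 & bounded_set Omega].

Definition open_box (a b : 'rV[R]_d) : set 'rV[R]_d :=
  [set x | forall i, a 0 i < x 0 i < b 0 i].

(* A bounded set of finite perimeter in the sense of De Giorgi: the divergence
   theorem for C^1 vector fields defines the perimeter measure sigma and the
   outer unit normal nu, and determines them uniquely (nu up to
   sigma-negligible sets), as the polar decomposition of - D 1_Omega. For a
   bounded Lipschitz domain, sigma is the surface measure of the boundary and
   nu the classical outer normal. *)
Record finite_perimeter Omega
    (sigma : {finite_measure set 'rV[R]_d -> \bar R})
    (nu : 'rV[R]_d -> 'rV[R]_d) : Prop := {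
  perimeter_boundary : sigma (~` boundary Omega) = 0%E;
  normal_measurable : measurable_fun setT nu;
  normal_unit : {ae sigma, forall x, \sum_(i < d) nu x 0 i ^+ 2 = 1};
  gauss_green : forall (U : set 'rV[R]_d) (F : 'I_d -> 'rV[R]_d -> R),
    open U -> closure Omega `<=` U -> (forall i, C1_on U (F i)) ->
    \int[leb R d]_(x in Omega) (\sum_(i < d) partial i (F i) x) =
    \int[sigma]_(x in boundary Omega) (\sum_(i < d) F i x * nu x 0 i)
}.

(* C^2 functions on R^d, periodic with cell [a, b] *)
Definition periodic_bc (a b : 'rV[R]_d) f : Prop :=
  C2_on setT f /\
  forall i x, f (x + (b 0 i - a 0 i) *: delta_mx 0 i) = f x.

(* functions of class C^2 up to the boundary of Omega (values of f away from
   the closure of Omega are irrelevant) with zero normal derivative *)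
Definition neumann_bc Omega
    (sigma : {finite_measure set 'rV[R]_d -> \bar R})
    (nu : 'rV[R]_d -> 'rV[R]_d) f : Prop :=
  (exists U, [/\ open U, closure Omega `<=` U & C2_on U f]) /\
  {ae sigma, forall x, \sum_(i < d) partial i f x * nu x 0 i = 0}.

End Calculus.

Section Caputo.
Variable R : realType.
Local Notation mu := (@lebesgue_measure R).

Definition Gamma (x : R) : R :=
  \int[mu]_(s in `]0, +oo[%classic) (s `^ (x - 1) * expR (- s)).

Definition tau (t : nat -> R) (k : nat) : R := t k - t k.-1.

(* [L1p_coef alpha t n k] is the coefficient b^(n)_{n-k}, for 1 <= k <= n. *)
Definition L1p_coef (alpha : R) (t : nat -> R) (n k : nat) : R :=
  (Gamma (1 - alpha) * tau t n * tau t k)^-1 *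
  \int[mu]_(v in `[t n.-1, t n]%classic)
    \int[mu]_(s in `[t k.-1, Num.min (t k) v]%classic) (v - s) `^ (- alpha).

(* [L1p_caputo alpha t u n] is the value at t_{n-1/2}, for 1 <= n. *)
Definition L1p_caputo (alpha : R) (t u : nat -> R) (n : nat) : R :=
  \sum_(1 <= k < n.+1) L1p_coef alpha t n k * (u k - u k.-1).

End Caputo.

Section Energy.
Variables (R : realType) (d : nat).
Implicit Types (Omega : set 'rV[R]_d) (phi r : 'rV[R]_d -> R).

Definition energy (eps : R) Omega phi : R :=
  \int[leb R d]_(x in Omega)
    (eps ^+ 2 / 2 * grad_normsq phi x + 1 / 4 * (phi x ^+ 2 - 1) ^+ 2).

Definition modified_energy (eps S : R) Omega phi r : R :=
  \int[leb R d]_(x in Omega)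
    (eps ^+ 2 / 2 * grad_normsq phi x
     + 1 / 2 * (r x + S) * (phi x ^+ 2 - 1 - S)
     - 1 / 4 * r x ^+ 2)
  + S ^+ 2 / 4 * fine (leb R d Omega).

(* phi^{n+1/2} *)
Definition midpoint (phi : nat -> 'rV[R]_d -> R) (n : nat) : 'rV[R]_d -> R :=
  fun x => (phi n.+1 x + phi n x) / 2.

End Energy.

(* Main.v *)
Require Import Defs.
From HB Require Import structures.
From mathcomp Require Import all_boot all_order all_algebra.
From mathcomp Require Import all_classical all_reals all_analysis.
From mathcomp Require Import measurable_realfun ring lra.
Import Order.TTheory GRing.Theory Num.Theory.
Import numFieldNormedType.Exports.
Local Open Scope classical_set_scope.
Local Open Scope ring_scope.

Set Implicit Arguments.
Unset Strict Implicit.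
Unset Printing Implicit Defensive.

(** Why the modified energy cannot grow.

    Write e_n for the density of the modified energy at level n, phi_n for
    phi^n, mu_n for mu^{n+1/2} and delta_n = phi_{n+1} - phi_n. The relaxation
    equation makes the variation of the terms in r collapse to
    (r_{n+1} + S) (phi_{n+1}^2 - phi_n^2) / 2, so that, at each point of Omega,
      e_{n+1} - e_n = mu_n delta_n + eps^2 div (delta_n grad phi_{n+1/2}),
    which is [density_step]. Under either boundary condition the divergence
    term has zero integral: in a periodic cell by Fubini and the fundamental
    theorem of calculus in one direction ([integral_green_periodic]), for
    Neumann data by the divergence theorem ([integral_green_neumann]).

    It remains to sign the sum of the integrals of mu_j delta_j. The L1+
    operator acts on the increments through a lower triangular matrix B with
    positive diagonal, and the first equation of the scheme says that
    B delta = M Lap mu at each point. Solving for delta,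
      sum_j mu_j delta_j = M sum_{j,k} (B^-1)_{jk} mu_j Lap mu_k
        = M sum_{j,k} (B^-1)_{jk} div (mu_j grad mu_k)
          - M sum_i sum_{j,k} (B^-1)_{jk} d_i mu_j d_i mu_k.
    The divergences again integrate to zero, and the last sum is nonnegative
    at each point as soon as the quadratic form of B^-1 is, which follows from
    the same property of B ([invmx_L1p_psd]). The energy inequality is thus
    obtained from a pointwise inequality between densities ([density_le]).

    The quadratic form of B ([L1p_mx_psd]) is where the fractional derivative
    enters. Integrating |v - s|^{-a} over the cells of the grid shows
    ([L1p_coefE]) that, after division by the steps and up to a positive
    factor, the symmetric part of B is the matrix of mixed differences of
    - |x|^{2-a}: the covariance matrix of the increments of a fractional
    Brownian motion. Its positivity is read off the representation
      |x|^{2-a} = c int_0^oo (1 - cos (x s)) s^{a-3} ds,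
    proved by rescaling the integral ([coskI_eq]): under the integral sign the
    mixed differences of cos (x s) form a sum of two squares
    ([increments_powR_ge0]). The grid may be arbitrary, since only the
    differences t_j - t_k occur. *)

(** * Integrals of finite sums *)

Section FiniteSums.
Context d (T : measurableType d) (R : realType).
Variables (mu : {measure set T -> \bar R}) (D : set T).
Hypothesis mD : measurable D.

Lemma integrable_sumr (I : Type) (r : seq I) (f : I -> T -> R) :
  (forall i, mu.-integrable D (EFin \o f i)) ->
  mu.-integrable D (EFin \o (fun x => \sum_(i <- r) f i x)).
Proof.
move=> fi; have -> : EFin \o (fun x => \sum_(i <- r) f i x) =
    (fun x => \sum_(i <- r) (EFin \o f i) x)%E.
  by apply/funext => x /=; rewrite sumEFin.
exact: integrable_sum.
Qed.

Lemma Rintegral_sum (I : Type) (r : seq I) (f : I -> T -> R) :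
  (forall i, mu.-integrable D (EFin \o f i)) ->
  \int[mu]_(x in D) (\sum_(i <- r) f i x) = \sum_(i <- r) \int[mu]_(x in D) f i x.
Proof.
move=> fi; elim: r => [|i r IH].
  rewrite big_nil; under eq_Rintegral do rewrite big_nil.
  by rewrite /Rintegral integral0.
rewrite big_cons -IH -RintegralD//; last exact: integrable_sumr.
by apply: eq_Rintegral => x _; rewrite big_cons.
Qed.

Lemma integrable_scale (c : R) (f : T -> R) : mu.-integrable D (EFin \o f) ->
  mu.-integrable D (EFin \o (fun x => c * f x)).
Proof.
move=> fi; have -> : EFin \o (fun x => c * f x) = (fun x => c%:E * (EFin \o f) x)%E.
  by apply/funext.
exact: integrableZl.
Qed.

End FiniteSums.

(** * Integrals of powers with a singular endpoint *)

Section FTC.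
Variable R : realType.
Local Notation mu := (@lebesgue_measure R).

(** The integrand may blow up at both endpoints, as (v - s)^{-a} does:
    the usual theorem is applied on compact subintervals that exhaust ]a, b[,
    and monotone convergence gives the limit. *)
Lemma ge0_integral_oo_FTC (f F : R -> R) (a b : R) : a < b ->
  (forall x, a < x < b -> 0 <= f x) ->
  (forall x, a < x < b -> {for x, continuous f}) ->
  (forall x, a < x < b -> is_derive x 1 F (f x)) ->
  F x @[x --> a^'+] --> F a -> F x @[x --> b^'-] --> F b ->
  (\int[mu]_(x in `]a, b[) (f x)%:E = (F b - F a)%:E)%E.
Proof.
move=> ab f0 cf dF Fa Fb.
(* The subintervals are [a + h n, b - h n]; the offset 3 keeps them
   nondegenerate for all n. *)
pose h n : R := (b - a) / n.+3%:R.
have h0 n : 0 < h n by rewrite divr_gt0// subr_gt0.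
have hle n : h n <= (b - a) / 3.
  by rewrite ler_pM2l ?subr_gt0// lef_pV2 ?posrE// ler_nat.
have hcvg : h n @[n --> \oo] --> 0.
  rewrite -[X in _ --> X](mulr0 (b - a)); apply: cvgMr.
  have -> : (fun n => n.+3%:R^-1 : R) = (fun n => harmonic (n + 2)%N).
    by apply/funext => n; rewrite /harmonic addn2.
  by rewrite (cvg_shiftn 2); exact: cvg_harmonic.
pose D n := `[a + h n, b - h n]%classic.
have Doo n x : D n x -> a < x < b.
  rewrite /D/= in_itv/= => /andP[ax xb]; have := h0 n; lra.
have DE : \bigcup_n D n = `]a, b[%classic.
  rewrite predeqE => x; split => [[n _ /Doo]|]; first by rewrite /= in_itv.
  rewrite /= in_itv/= => /andP[ax xb].
  have hx : 0 < Num.min (x - a) (b - x) by rewrite lt_min !subr_gt0 ax.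
  have [n _ /(_ n (leqnn _))/=] : \forall n \near \oo, h n < Num.min (x - a) (b - x).
    exact: (cvgr_lt _ hcvg).
  rewrite lt_min => /andP[h1 h2]; exists n => //.
  by rewrite /D/= in_itv/=; apply/andP; split; lra.
have cfw n : {within D n, continuous f}.
  by apply: continuous_in_subspaceT => x /set_mem /Doo; exact: cf.
have ndD : nondecreasing_seq D.
  apply/nondecreasing_seqP => n; rewrite subsetEset /D => x/=.
  have : h n.+1 <= h n by rewrite ler_pM2l ?subr_gt0// lef_pV2 ?posrE// ler_nat.
  rewrite !in_itv/= => ? /andP[? ?]; apply/andP; split; lra.
have mD n : measurable (D n : set (measurableTypeR R)) by exact: measurable_itv.
have mfD n : measurable_fun (D n : set (measurableTypeR R)) (EFin \o f).
  by apply/measurable_EFinP; apply: subspace_continuous_measurable_fun; [exact: mD|exact: cfw].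
have f0D n x : D n x -> (0 <= (EFin \o f) x)%E.
  by move=> /Doo xab; rewrite lee_fin f0.
have /cvg_lim := @ge0_nondecreasing_set_cvg_integral _ (measurableTypeR R) R D
  (EFin \o f) mu ndD mD mfD f0D.
rewrite DE => <- //.
have -> : (fun n => \int[mu]_(x in D n) (EFin \o f) x)%E =
          (fun n => (F (b - h n) - F (a + h n))%:E).
  apply/funext => n; rewrite /D.
  have hn := h0 n; have hl := hle n.
  rewrite (@continuous_FTC2 _ f F) ?EFinB//.
  - lra.
  - exact: (cfw n).
  - split.
    + by move=> x; rewrite in_itv/= => xn; apply: ex_derive; apply: dF; lra.
    + apply: cvg_at_right_filter; apply: differentiable_continuous.
      by apply/derivable1_diffP; apply: ex_derive; apply: dF; lra.
    + apply: cvg_at_left_filter; apply: differentiable_continuous.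
      by apply/derivable1_diffP; apply: ex_derive; apply: dF; lra.
  - move=> x; rewrite in_itv/= => xn; rewrite derive1E.
    by apply: derive_val; apply: dF; lra.
have Ha : F (a + h n) @[n --> \oo] --> F a.
  move/cvg_at_rightP : Fa; apply; split; first by move=> n; rewrite ltrDl.
  by rewrite -[X in _ --> X]addr0; apply: cvgD => //; exact: cvg_cst.
have Hb : F (b - h n) @[n --> \oo] --> F b.
  move/cvg_at_leftP : Fb; apply; split; first by move=> n; rewrite gtrBl.
  by rewrite -[X in _ --> X]subr0; apply: cvgB => //; exact: cvg_cst.
by apply/cvg_lim => //; apply: cvg_EFin; [near=> n|exact: cvgB].
Unshelve. all: by end_near. Qed.

End FTC.

Section PowerIntegrals.
Variable R : realType.
Local Notation mu := (@lebesgue_measure R).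

(** Absolute values make the power continuous on the whole line: on its own
    [powR] is 1 at negative arguments, so its left limit at 0 is 1. *)
Lemma continuous_normr_powR (q : R) : 0 < q ->
  continuous (fun x : R => `|x| `^ q).
Proof.
move=> q0 x; have [->|x0] := eqVneq x 0; last first.
  apply: (@continuous_comp R R R (fun y : R => `|y|) (fun y : R => y `^ q)).
    exact: norm_continuous.
  apply: differentiable_continuous; apply/derivable1_diffP.
  by apply: derivable_powR; rewrite in_itv/= andbT normr_gt0.
rewrite /continuous_at normr0 powR0 ?gt_eqF//.
apply/cvgrPdist_lt => e e0; near=> y.
rewrite sub0r normrN ger0_norm ?powR_ge0//.
have -> : e = (e `^ q^-1) `^ q by rewrite -powRrM mulVf ?gt_eqF// powRr1 ?ltW.
apply: gt0_ltr_powR => //; rewrite ?nnegrE ?powR_ge0//.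
near: y; exists (e `^ q^-1); first by rewrite /= powR_gt0.
by move=> z /=; rewrite sub0r normrN.
Unshelve. all: by end_near. Qed.

Lemma is_derive_powR_subl (a x q : R) : q != 0 -> a < x ->
  is_derive x 1 (fun v => (v - a) `^ q / q) ((x - a) `^ (q - 1)).
Proof.
move=> q0 ax.
have h : is_derive (x - a) 1 ((@powR R) ^~ q) (q * (x - a) `^ (q - 1)).
  by apply: is_derive1_powR; rewrite subr_gt0.
have -> : (fun v => (v - a) `^ q / q) = (fun v => q^-1 *: ((@powR R) ^~ q \o (fun v => v - a)) v).
  by apply/funext => v /=; rewrite mulrC.
apply: is_derive_eq.
by rewrite subr0 mulr1 /= -[_ *: _]/(_ * _) mulrA mulVf// mul1r.
Qed.

Lemma is_derive_powR_subr (c x q : R) : q != 0 -> x < c ->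
  is_derive x 1 (fun v => - ((c - v) `^ q / q)) ((c - x) `^ (q - 1)).
Proof.
move=> q0 ax.
have h : is_derive (c - x) 1 ((@powR R) ^~ q) (q * (c - x) `^ (q - 1)).
  by apply: is_derive1_powR; rewrite subr_gt0.
have -> : (fun v => - ((c - v) `^ q / q)) =
  (fun v => - q^-1 *: ((@powR R) ^~ q \o (fun v => c - v)) v).
  by apply/funext => v /=; rewrite -[_ *: _]/(_ * _) mulNr mulrC.
apply: is_derive_eq.
by rewrite add0r mul1r /= -[_ *: _]/(_ * _) mulrN1 mulrNN mulrA mulVf// mul1r.
Qed.

Lemma continuous_powR_gt0 (x q : R) : 0 < x ->
  {for x, continuous (fun y : R => y `^ q)}.
Proof.
move=> x0; apply: differentiable_continuous; apply/derivable1_diffP.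
by apply: derivable_powR; rewrite in_itv/= andbT.
Qed.

Lemma continuous_powR_subl (a x q : R) : a < x ->
  {for x, continuous (fun v => (v - a) `^ q)}.
Proof.
move=> ax; apply: (@continuous_comp R R R (fun v => v - a) ((@powR R) ^~ q)).
  by apply: cvgB; [exact: cvg_id|exact: cvg_cst].
by apply: continuous_powR_gt0; rewrite subr_gt0.
Qed.

Lemma continuous_powR_subr (c x q : R) : x < c ->
  {for x, continuous (fun v => (c - v) `^ q)}.
Proof.
move=> ax; apply: (@continuous_comp R R R (fun v => c - v) ((@powR R) ^~ q)).
  by apply: cvgB; [exact: cvg_cst|exact: cvg_id].
by apply: continuous_powR_gt0; rewrite subr_gt0.
Qed.

Lemma continuous_dist_powR (a q : R) : 0 < q ->
  continuous (fun v => `|v - a| `^ q).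
Proof.
move=> q0 v; apply: (@continuous_comp R R R (fun v => v - a) (fun v => `|v| `^ q)).
  by apply: cvgB; [exact: cvg_id|exact: cvg_cst].
exact: continuous_normr_powR.
Qed.

Lemma cvg_right_powR_subl (a p q : R) : 0 < q -> a <= p ->
  (x - a) `^ q @[x --> p^'+] --> (p - a) `^ q.
Proof.
move=> q0 ap; have -> : p - a = `|p - a| by rewrite ger0_norm// subr_ge0.
apply: (@cvg_trans _ ((fun v => `|v - a| `^ q) x @[x --> p^'+])).
  apply: near_eq_cvg; near=> x; rewrite ger0_norm// subr_ge0 (le_trans ap)// ltW//.
exact/cvg_at_right_filter/continuous_dist_powR.
Unshelve. all: by end_near. Qed.

Lemma cvg_left_powR_subr (c p q : R) : 0 < q -> p <= c ->
  (c - x) `^ q @[x --> p^'-] --> (c - p) `^ q.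
Proof.
move=> q0 ap; have -> : c - p = `|p - c| by rewrite distrC ger0_norm// subr_ge0.
apply: (@cvg_trans _ ((fun v => `|v - c| `^ q) x @[x --> p^'-])).
  apply: near_eq_cvg; near=> x; rewrite distrC ger0_norm// subr_ge0 (le_trans _ ap)// ltW//.
exact/cvg_at_left_filter/continuous_dist_powR.
Unshelve. all: by end_near. Qed.

Lemma integral_powR_subl (a p q g : R) : 0 < g -> a <= p -> p < q ->
  (\int[mu]_(x in `]p, q[) ((x - a) `^ (g - 1))%:E =
   (((q - a) `^ g - (p - a) `^ g) / g)%:E)%E.
Proof.
move=> g0 ap pq.
have dF x : p < x < q ->
    is_derive x 1 (fun v => (v - a) `^ g / g) ((x - a) `^ (g - 1)).
  by move=> /andP[px xq]; apply: is_derive_powR_subl; [rewrite gt_eqF|lra].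
rewrite (ge0_integral_oo_FTC pq _ _ dF) ?mulrBl//.
- by move=> x xpq; exact: powR_ge0.
- by move=> x /andP[px xq]; apply: continuous_powR_subl; lra.
- by apply: cvgMl; exact: cvg_right_powR_subl.
- apply: cvgMl; apply: cvg_at_left_filter; apply: continuous_powR_subl; lra.
Qed.

Lemma integral_powR_subr (c p q g : R) : 0 < g -> q <= c -> p < q ->
  (\int[mu]_(x in `]p, q[) ((c - x) `^ (g - 1))%:E =
   (((c - p) `^ g - (c - q) `^ g) / g)%:E)%E.
Proof.
move=> g0 ap pq.
have dF x : p < x < q ->
    is_derive x 1 (fun v => - ((c - v) `^ g / g)) ((c - x) `^ (g - 1)).
  by move=> /andP[px xq]; apply: is_derive_powR_subr; [rewrite gt_eqF|lra].
rewrite (ge0_integral_oo_FTC pq _ _ dF).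
- by rewrite opprK addrC mulrBl.
- by move=> x xpq; exact: powR_ge0.
- by move=> x /andP[px xq]; apply: continuous_powR_subr; lra.
- apply: cvgN; apply: cvgMl; apply: cvg_at_right_filter; apply: continuous_powR_subr; lra.
- by apply: cvgN; apply: cvgMl; exact: cvg_left_powR_subr.
Qed.

Lemma within_continuous_invsqr :
  {within `[1, +oo[, continuous (fun x : R => x ^- 2)}.
Proof.
apply: continuous_in_subspaceT => x /set_mem/=; rewrite in_itv/= andbT => x1.
apply: cvgV; first by rewrite expf_neq0// gt_eqF// (lt_le_trans _ x1).
exact: exprn_continuous.
Qed.

Lemma integral_invsqr_1y :
  (\int[mu]_(x in `[1%R, +oo[) (x ^- 2)%:E = 1%:E)%E.
Proof.
have dF (x : R) : 1 < x -> is_derive x 1 (fun y : R => - y^-1) (x ^- 2).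
  move=> x1; have x0 : x != 0 by rewrite gt_eqF// (lt_trans _ x1).
  have dV : derivable (fun y : R => y^-1) x 1.
    by apply/derivable1_diffP; exact: differentiable_Rinv.
  apply: DeriveDef; first exact: derivableN.
  rewrite deriveN// deriveE; last exact: differentiable_Rinv.
  by rewrite diff_Rinv//= -[_ *: _]/(_ * _) mulr1 opprK.
rewrite (@ge0_continuous_FTC2y _ (fun x => x ^- 2) (fun x => - x^-1) 1 0).
- by rewrite invr1 -EFinB sub0r opprK.
- by move=> x x1; rewrite invr_ge0 exprn_ge0// (le_trans _ x1).
- exact: within_continuous_invsqr.
- rewrite -oppr0; apply: cvgN; apply/(@gtr0_cvgV0 _ _ _ _ (id : R -> R)); last exact: cvg_id.
  by near=> x; near: x; exact: nbhs_pinfty_gt.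
- by move=> x x1; apply: ex_derive; apply: dF.
- apply: cvgN; apply: cvg_at_right_filter; apply: cvgV => //; exact: cvg_id.
- by move=> x; rewrite in_itv/= andbT => x1; rewrite derive1E; apply: derive_val; apply: dF.
Unshelve. all: by end_near. Qed.

(** A common criterion for the two improper integrals below, that of the
    gamma function and that of the cosine kernel: domination by a power
    integrable at 0 and by s^-2 at infinity. *)
Lemma integrable_0y_of_le (f : R -> R) (C g : R) : 0 < g -> 0 <= C ->
  (forall s, 0 < s -> {for s, continuous f}) ->
  (forall s, 0 < s -> 0 <= f s) ->
  (forall s, 0 < s < 1 -> f s <= C * s `^ (g - 1)) ->
  (forall s, 1 <= s -> f s <= C * s ^- 2) ->
  mu.-integrable `]0%R, +oo[ (EFin \o f).
Proof.
move=> g0 C0 cf f0 f1 f2.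
have mf : measurable_fun (`]0, +oo[%classic : set (measurableTypeR R)) f.
  apply: open_continuous_measurable_fun => // x /set_mem/=.
  by rewrite in_itv/= andbT; exact: cf.
have U : `]0, +oo[%classic = `]0, 1[%classic `|` `[1, +oo[%classic :> set R.
  by rewrite -itv_bndbnd_setU// bnd_simp.
have mv : measurable_fun (`[1, +oo[%classic : set (measurableTypeR R))
    (fun x : R => x ^- 2).
  apply: subspace_continuous_measurable_fun; first exact: measurable_itv.
  exact: within_continuous_invsqr.
have mf1 : measurable_fun (`]0, 1[%classic : set (measurableTypeR R)) f.
  by apply: measurable_funS mf => //; rewrite U; exact: subsetUl.
have mf2 : measurable_fun (`[1, +oo[%classic : set (measurableTypeR R)) f.
  by apply: measurable_funS mf => //; rewrite U; exact: subsetUr.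
apply/integrableP; split; first exact/measurable_EFinP.
have -> : (\int[mu]_(x in `]0%R, +oo[) `|(EFin \o f) x| =
           \int[mu]_(x in `]0%R, +oo[) (f x)%:E)%E.
  apply: eq_integral => x /set_mem/=; rewrite in_itv/= andbT => x0.
  by rewrite ger0_norm// f0.
rewrite U ge0_integral_setU//=; last 3 first.
- by rewrite -U; exact/measurable_EFinP.
- move=> x; rewrite lee_fin !in_itv/= andbT => -[/andP[x0 _]|x1]; apply: f0 => //.
  exact: lt_le_trans x1.
- rewrite disj_set2E; apply/eqP; rewrite -subset0 => x [] /=.
  by rewrite !in_itv/= andbT => /andP[_ x1]; rewrite leNgt x1.
apply: lte_add_pinfty.
- apply: (@le_lt_trans _ _ (\int[mu]_(x in `]0%R, 1%R[) (C%:E * (x `^ (g - 1))%:E))%E).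
    apply: ge0_le_integral => //=.
    + by move=> x; rewrite in_itv/= => /andP[x0 _]; rewrite lee_fin f0.
    + exact/measurable_EFinP.
    + apply/measurable_EFinP; apply: measurable_funM => //.
      exact: measurable_funTS (measurable_powR _).
  rewrite ge0_integralZl//=.
  + have := @integral_powR_subl 0 0 1 g g0 (lexx _) ltr01.
    under eq_integral do rewrite subr0.
    by move=> ->; rewrite -EFinM ltry.
  + by apply/measurable_EFinP; exact: measurable_funTS (measurable_powR _).
  + by move=> x _; rewrite lee_fin powR_ge0.
- apply: (@le_lt_trans _ _ (\int[mu]_(x in `[1%R, +oo[) (C%:E * (x ^- 2)%:E))%E).
    apply: ge0_le_integral => //=.
    + move=> x; rewrite in_itv/= andbT => x1; rewrite lee_fin f0//.
      exact: lt_le_trans x1.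
    + exact/measurable_EFinP.
    + apply/measurable_EFinP; exact: measurable_funM.
    + by move=> x; rewrite in_itv/= andbT => x01; rewrite -EFinM lee_fin f2.
  rewrite ge0_integralZl//=.
  + by rewrite integral_invsqr_1y -EFinM ltry.
  + exact/measurable_EFinP.
  + by move=> x; rewrite in_itv/= andbT => x1; rewrite lee_fin invr_ge0 sqr_ge0.
Qed.

(** A continuous function that is positive on [1, 2] is bounded below there
    by its positive minimum. *)
Lemma Rintegral_0y_gt0 (f : R -> R) :
  mu.-integrable `]0%R, +oo[ (EFin \o f) ->
  (forall s, 0 < s -> {for s, continuous f}) ->
  (forall s, 0 < s -> 0 <= f s) -> (forall s, 1 <= s <= 2 -> 0 < f s) ->
  0 < \int[mu]_(s in `]0, +oo[) f s.
Proof.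
move=> fi cf f0 fpos.
have cf12 : {within `[1, 2], continuous f}.
  apply: continuous_in_subspaceT => x /set_mem/=; rewrite in_itv/= => /andP[x1 _].
  by apply: cf; exact: lt_le_trans x1.
have le12 : 1 <= 2 :> R by lra.
have [c c12 cmin] := EVT_min le12 cf12.
have fc0 : 0 < f c by apply: fpos; move: c12; rewrite in_itv.
have sub : (`[1, 2]%classic : set R) `<=` `]0, +oo[%classic.
  by move=> x/=; rewrite !in_itv/= andbT => /andP[x1 _]; exact: lt_le_trans x1.
apply: (@lt_le_trans _ _ (f c)) => //.
rewrite -lee_fin /Rintegral fineK; last exact: integrable_fin_num.
apply: (@le_trans _ _ (\int[mu]_(x in `[1%R, 2%R]) (f x)%:E)%E).
  apply: (@le_trans _ _ (\int[mu]_(x in `[1%R, 2%R]) (f c)%:E)%E).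
    rewrite integral_cst//= lebesgue_measure_itv/= lte_fin ifT; last by lra.
    by rewrite -EFinB -EFinM lee_fin; have := fc0; nra.
  apply: ge0_le_integral => //=.
  - by move=> x _; rewrite lee_fin ltW.
  - apply/measurable_EFinP; apply: subspace_continuous_measurable_fun => //.
apply: ge0_subset_integral => //=.
- by case/integrableP : fi.
- by move=> x; rewrite in_itv/= andbT lee_fin; exact: f0.
Qed.

(** Since the real-valued integral is 0 when the integral diverges, positivity
    includes the convergence of the integral. *)
Lemma Gamma_gt0 (x : R) : 0 < x < 1 -> 0 < Gamma x.
Proof.
move=> /andP[x0 x1].
have cf s : 0 < s -> {for s, continuous (fun s : R => s `^ (x - 1) * expR (- s))}.
  move=> s0; apply: cvgM.
    exact: continuous_powR_gt0.
  apply: (@continuous_comp R R R -%R expR); first exact: opp_continuous.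
  exact: continuous_expR.
apply: Rintegral_0y_gt0 => //.
- apply: (@integrable_0y_of_le _ 4 x) => //.
  + by move=> s s0; rewrite mulr_ge0 ?powR_ge0 ?expR_ge0.
  + move=> s /andP[s0 s1]; rewrite mulrC ler_wpM2r ?powR_ge0//.
    by rewrite (@le_trans _ _ 1)// ?expR_le1 ?oppr_le0 ?ltW//; lra.
  + move=> s s1; have s0 : 0 < s by exact: lt_le_trans s1.
    have h1 : s `^ (x - 1) <= 1.
      by rewrite -[leRHS](@powRr0 _ s) ler_powR//; lra.
    have h2 : s ^+ 2 / 2 <= expR s.
      have := @expR_ge1Dxn R s 1 (ltW s0); rewrite (_ : 2`! = 2%N)//; lra.
    rewrite expRN (@le_trans _ _ (expR s)^-1)// ?ler_piMl// ?invr_ge0 ?expR_ge0//.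
    rewrite (@le_trans _ _ (s ^+ 2 / 2)^-1)//.
      by rewrite lef_pV2// posrE ?expR_gt0 ?divr_gt0 ?exprn_gt0.
    have : 0 <= s ^- 2 by rewrite invr_ge0 sqr_ge0.
    by rewrite invf_div; lra.
- by move=> s s0; rewrite mulr_ge0 ?powR_ge0 ?expR_ge0.
- move=> s /andP[s1 _]; rewrite mulr_gt0 ?expR_gt0 ?powR_gt0//.
  exact: lt_le_trans s1.
Qed.

(** The half-line is cut away from 0, where G may be singular; the cut is
    removed by monotone convergence in [ge0_integral_scale_0y]. *)
Lemma ge0_integral_scale_cy (G : R -> R) (c a : R) : 0 < c -> 0 < a ->
  (forall s, 0 < s -> {for s, continuous G}) -> (forall s, 0 < s -> 0 <= G s) ->
  (\int[mu]_(s in `[(c * a)%R, +oo[) (G s)%:E =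
   \int[mu]_(s in `[a, +oo[) (G (c * s) * c)%:E)%E.
Proof.
move=> c0 a0 cG G0.
have dF (x : R) : is_derive x 1 ( *%R c) c.
  by apply: is_derive_eq; rewrite -[_ *: _]/(_ * _) mulr1 ?mul0r ?scaler0 ?addr0.
have F'E : (( *%R c : R -> R)^`())%classic = cst c.
  by apply/funext => x; rewrite derive1E; apply: derive_val.
rewrite (@increasing_ge0_integration_by_substitutiony _ ( *%R c)) ?F'E//.
- by move=> x y _ _ xy; rewrite ltr_pM2l.
- by move=> x _; exact: cvg_cst.
- exact: is_cvg_cst.
- exact: is_cvg_cst.
- split; first by move=> x _; apply: ex_derive.
  by apply: cvg_at_right_filter; apply: cvgMr; exact: cvg_id.
- by apply: gt0_cvgMry => //; exact: cvg_id.
- apply: continuous_in_subspaceT => x /set_mem/=; rewrite in_itv/= andbT => x1.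
  by apply: cG; rewrite (lt_le_trans _ x1)// mulr_gt0.
- by move=> x; rewrite in_itv/= andbT => x1; apply: G0; rewrite (lt_trans _ x1)// mulr_gt0.
Qed.

Lemma ge0_cvg_integral_0y (G : R -> R) (c : R) : 0 < c ->
  (forall s, 0 < s -> {for s, continuous G}) -> (forall s, 0 < s -> 0 <= G s) ->
  (\int[mu]_(s in `[(c * n.+1%:R^-1)%R, +oo[) (G s)%:E @[n --> \oo] -->
   \int[mu]_(s in `]0%R, +oo[) (G s)%:E)%E.
Proof.
move=> c0 cG G0.
pose D n : set (measurableTypeR R) := `[(c * n.+1%:R^-1)%R, +oo[%classic.
have Dgt0 n x : D n x -> 0 < x.
  by rewrite /D/= in_itv/= andbT; apply: lt_le_trans; rewrite mulr_gt0.
have DE : \bigcup_n D n = `]0, +oo[%classic.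
  rewrite predeqE => x; split => [[n _ /Dgt0]|]; first by rewrite /= in_itv/= andbT.
  rewrite /= in_itv/= andbT => x0.
  have hcvg : c * n.+1%:R^-1 @[n --> \oo] --> 0.
    by rewrite -[X in _ --> X](mulr0 c); apply: cvgMr; exact: cvg_harmonic.
  have [n _ /(_ n (leqnn _))/= h] : \forall n \near \oo, c * n.+1%:R^-1 < x.
    exact: (cvgr_lt _ hcvg).
  by exists n => //; rewrite /D/= in_itv/= andbT ltW.
rewrite -DE.
apply: (@ge0_nondecreasing_set_cvg_integral _ (measurableTypeR R) R D (EFin \o G) mu).
- apply/nondecreasing_seqP => n; rewrite subsetEset /D => x/=.
  rewrite !in_itv/= !andbT; apply: le_trans.
  by rewrite ler_pM2l// lef_pV2 ?posrE// ler_nat.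
- by move=> n; exact: measurable_itv.
- move=> n; apply/measurable_EFinP; apply: subspace_continuous_measurable_fun.
    exact: measurable_itv.
  by apply: continuous_in_subspaceT => x /set_mem /Dgt0; exact: cG.
- by move=> n x /Dgt0 x0; rewrite lee_fin G0.
Qed.

Lemma ge0_integral_scale_0y (G : R -> R) (c : R) : 0 < c ->
  (forall s, 0 < s -> {for s, continuous G}) -> (forall s, 0 < s -> 0 <= G s) ->
  (\int[mu]_(s in `]0%R, +oo[) (G s)%:E =
   \int[mu]_(s in `]0%R, +oo[) (G (c * s) * c)%:E)%E.
Proof.
move=> c0 cG G0.
have /cvg_lim <- // := ge0_cvg_integral_0y c0 cG G0.
have cG' (s : R) : 0 < s -> {for s, continuous (fun s => G (c * s) * c)}.
  move=> s0; apply: cvgMl; apply: (@continuous_comp R R R ( *%R c) G).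
    by apply: cvgMr; exact: cvg_id.
  by apply: cG; rewrite mulr_gt0.
have G'0 (s : R) : 0 < s -> 0 <= G (c * s) * c.
  by move=> s0; rewrite mulr_ge0 ?G0 ?mulr_gt0// ltW.
have /cvg_lim <- // := ge0_cvg_integral_0y ltr01 cG' G'0.
congr (limn _); apply/funext => n.
by rewrite ge0_integral_scale_cy// mul1r.
Qed.

End PowerIntegrals.

(** * Integrals of powers over closed intervals *)

Section ClosedPowerIntegrals.
Variable R : realType.
Local Notation mu := (@lebesgue_measure R).

Lemma measurable_powR_subl (D : set (measurableTypeR R)) (a g : R) :
  measurable_fun D (fun x : measurableTypeR R => (x - a) `^ g).
Proof.
apply: measurable_funTS; apply: (@measurableT_comp _ _ _ _ _ _ (@powR R ^~ g)) => //.
exact: measurable_funB.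
Qed.

Lemma measurable_powR_subr (D : set (measurableTypeR R)) (a g : R) :
  measurable_fun D (fun x : measurableTypeR R => (a - x) `^ g).
Proof.
apply: measurable_funTS; apply: (@measurableT_comp _ _ _ _ _ _ (@powR R ^~ g)) => //.
exact: measurable_funB.
Qed.

Lemma integral_cc_powR_subl (a p q g : R) : 0 < g -> a <= p -> p < q ->
  (\int[mu]_(x in `[p, q]) ((x - a) `^ (g - 1))%:E =
   (((q - a) `^ g - (p - a) `^ g) / g)%:E)%E.
Proof.
move=> g0 ap pq; rewrite integral_itv_bndoo; first exact: integral_powR_subl.
by apply/measurable_EFinP; exact: measurable_powR_subl.
Qed.

Lemma Rintegral_cc_powR_subl (a p q g : R) : 0 < g -> a <= p -> p < q ->
  \int[mu]_(x in `[p, q]) ((x - a) `^ (g - 1)) =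
  ((q - a) `^ g - (p - a) `^ g) / g.
Proof. by move=> *; rewrite /Rintegral integral_cc_powR_subl. Qed.

Lemma integrable_cc_powR_subl (a p q g : R) : 0 < g -> a <= p -> p < q ->
  mu.-integrable `[p, q] (EFin \o (fun x => (x - a) `^ (g - 1))).
Proof.
move=> g0 ap pq; apply/integrableP; split.
  by apply/measurable_EFinP; exact: measurable_powR_subl.
under eq_integral do rewrite /= ger0_norm ?powR_ge0//.
by rewrite integral_cc_powR_subl// ltry.
Qed.

Lemma Rintegral_cc_powR_subr (c p q g : R) : 0 < g -> q <= c -> p <= q ->
  \int[mu]_(x in `[p, q]) ((c - x) `^ (g - 1)) =
  ((c - p) `^ g - (c - q) `^ g) / g.
Proof.
move=> g0 qc; rewrite le_eqVlt => /predU1P[->|pq].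
  by rewrite set_itv1 Rintegral_set1 subrr mul0r.
rewrite /Rintegral integral_itv_bndoo ?integral_powR_subr//.
by apply/measurable_EFinP; exact: measurable_powR_subr.
Qed.

End ClosedPowerIntegrals.

(** * The matrix of the L1+ formula *)

Section L1plus.
Variables (R : realType) (a : R).
Hypothesis a01 : 0 < a < 1.
Local Notation mu := (@lebesgue_measure R).

(** The exponent a - 3 is the one for which rescaling s turns the integral
    into |x|^{2-a}; the kernel is of order s^{a-1} at 0 and s^{a-3} at
    infinity, hence integrable for 0 < a < 1. *)
Definition cosk (x s : R) : R := (1 - cos (x * s)) * s `^ (a - 3).
Definition coskI (x : R) : R := \int[mu]_(s in `]0, +oo[) cosk x s.

Lemma sin_le_norm (y : R) : `|sin y| <= `|y|.
Proof.
wlog y0 : y / 0 <= y.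
  move=> H; have [/H//|/ltW y0] := leP 0 y.
  by have := H (- y); rewrite sinN !normrN; apply; rewrite oppr_ge0.
have [c _] := MVT_segment y0 (fun x _ => is_derive_sin x)
  (continuous_subspaceT (@continuous_sin R)).
rewrite sin0 !subr0 => ->.
by rewrite normrM ler_piMl// cos_max.
Qed.

Lemma one_sub_cos_le (x : R) : 1 - cos x <= x ^+ 2.
Proof.
set u := x / 2; have -> : x = u *+ 2 by rewrite /u mulr2n; lra.
rewrite cos_mulr2n cos2sin2.
have := sin_le_norm u.
rewrite -ler_sqr ?nnegrE// !real_normK ?num_real// !mulr2n => h.
have := sqr_ge0 u; nra.
Qed.

Lemma cosk_ge0 x s : 0 <= cosk x s.
Proof. by rewrite mulr_ge0 ?powR_ge0// subr_ge0 cos_le1. Qed.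

Lemma continuous_cosk x s : 0 < s -> {for s, continuous (cosk x)}.
Proof.
move=> s0; apply: cvgM; last exact: continuous_powR_gt0.
apply: cvgB; first exact: cvg_cst.
apply: (@continuous_comp R R R ( *%R x) cos); last exact: continuous_cos.
by apply: cvgMr; exact: cvg_id.
Qed.

Lemma integrable_cosk x : mu.-integrable `]0, +oo[ (EFin \o cosk x).
Proof.
have /andP[a0 a1] := a01.
apply: (@integrable_0y_of_le _ _ (x ^+ 2 + 2) a) => //.
- by rewrite addr_ge0// sqr_ge0.
- exact: continuous_cosk.
- by move=> s _; exact: cosk_ge0.
- move=> s /andP[s0 s1].
  have -> : s `^ (a - 1) = s ^+ 2 * s `^ (a - 3).
    rewrite -powR_mulrn ?ltW// -powRD; first by congr (_ `^ _); lra.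
    by rewrite (gt_eqF s0) implybT.
  rewrite /cosk mulrA ler_wpM2r ?powR_ge0//.
  apply: (le_trans (one_sub_cos_le _)); rewrite exprMn.
  by have := sqr_ge0 s; have := sqr_ge0 x; nra.
- move=> s s1; have s0 : 0 < s by exact: lt_le_trans s1.
  rewrite -(powR_invn 2 (ltW s0)) /cosk.
  apply: (@le_trans _ _ (2 * s `^ (a - 3))).
    rewrite ler_wpM2r ?powR_ge0//; have := cos_geN1 (x * s); lra.
  have h : s `^ (a - 3) <= s `^ (- 2%:R) by apply: ler_powR => //; lra.
  have := powR_ge0 s (- 2%:R); have := sqr_ge0 x; nra.
Qed.

Lemma coskI1_gt0 : 0 < coskI 1.
Proof.
apply: Rintegral_0y_gt0; first exact: integrable_cosk.
- exact: continuous_cosk.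
- by move=> s _; exact: cosk_ge0.
- move=> s /andP[s1 s2]; rewrite mulr_gt0// ?powR_gt0 ?mul1r ?subr_gt0//; last first.
    exact: lt_le_trans s1.
  have s0 : 0 < s by exact: lt_le_trans s1.
  have pi2 := @pi_ge2 R.
  rewrite -[ltRHS]cos0 ltr_cos// in_itv/=; lra.
Qed.

(** Homogeneity: for x > 0 the substitution of x s for s gives
    cosk 1 (x s) x = x^{a-2} cosk x s. *)
Lemma coskI_eq x : coskI x = `|x| `^ (2 - a) * coskI 1.
Proof.
have /andP[a0 a1] := a01.
have [->|x0] := eqVneq x 0.
  rewrite normr0 powR0 ?mul0r; last by lra.
  rewrite /coskI (_ : cosk 0 = cst 0); last first.
    by apply/funext => s; rewrite /cosk mul0r cos0 subrr mul0r.
  by rewrite /Rintegral integral0.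
wlog {x0}x0 : x / 0 < x.
  move=> H; have [/H//|xn] := ltP 0 x.
  have <- : coskI (- x) = coskI x.
    by rewrite /coskI; apply: eq_Rintegral => s _; rewrite /cosk mulNr cosN.
  by rewrite H ?normrN// oppr_gt0 lt_neqAle x0.
rewrite gtr0_norm//.
have E s : 0 < s -> cosk 1 (x * s) * x = x `^ (a - 2) * cosk x s.
  move=> s0; rewrite /cosk mul1r powRM ?ltW//.
  have -> : (1 - cos (x * s)) * (x `^ (a - 3) * s `^ (a - 3)) * x =
    (x `^ (a - 3) * x) * ((1 - cos (x * s)) * s `^ (a - 3)) by ring.
  rewrite -{2}(powRr1 (ltW x0)) -powRD; last by rewrite (gt_eqF x0) implybT.
  by congr (_ `^ _ * _); lra.
have cE : (\int[mu]_(s in `]0%R, +oo[) (cosk 1 s)%:E =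
           \int[mu]_(s in `]0%R, +oo[) (cosk 1 (x * s) * x)%:E)%E.
  apply: ge0_integral_scale_0y => //; first exact: continuous_cosk.
  by move=> s _; exact: cosk_ge0.
have -> : coskI 1 = x `^ (a - 2) * coskI x.
  rewrite /coskI -RintegralZl//; last exact: integrable_cosk.
  rewrite {1}/Rintegral cE; apply: eq_Rintegral => s /set_mem/=.
  by rewrite in_itv/= andbT; exact: E.
rewrite mulrA -powRD; last by rewrite (gt_eqF x0) implybT.
by rewrite (_ : 2 - a + (a - 2) = 0) ?powRr0 ?mul1r//; lra.
Qed.

(** An inequality that holds for every frequency s passes to the mixture
    |x|^{2-a} of the functions 1 - cos (x s). *)
Lemma sum_normr_powR_ge0 (I : finType) (c x : I -> R) :
  (forall s, 0 < s -> 0 <= \sum_i c i * (1 - cos (x i * s))) ->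
  0 <= \sum_i c i * `|x i| `^ (2 - a).
Proof.
move=> H; rewrite -(pmulr_lge0 _ coskI1_gt0) mulr_suml.
have -> : \sum_i c i * `|x i| `^ (2 - a) * coskI 1 =
    \sum_i \int[mu]_(s in `]0, +oo[) (c i * cosk (x i) s).
  apply: eq_bigr => i _; rewrite -mulrA -coskI_eq RintegralZl//.
  exact: integrable_cosk.
rewrite -Rintegral_sum//; last first.
  by move=> i; apply: integrable_scale => //; exact: integrable_cosk.
apply: Rintegral_ge0 => s /=; rewrite in_itv/= andbT => s0.
rewrite (_ : \sum_i _ = (\sum_i c i * (1 - cos (x i * s))) * s `^ (a - 3)).
  by rewrite mulr_ge0 ?powR_ge0// H.
by rewrite mulr_suml; apply: eq_bigr => i _; rewrite mulrA.
Qed.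

(** The opposite of the mixed difference of |x|^{2-a} over the cells j and k:
    twice the covariance of two increments of a fractional Brownian motion of
    Hurst index 1 - a / 2. *)
Definition pow_incr (t : nat -> R) (j k : nat) : R :=
  `|t j.+1 - t k| `^ (2 - a) + `|t j - t k.+1| `^ (2 - a)
     - `|t j.+1 - t k.+1| `^ (2 - a) - `|t j - t k| `^ (2 - a).

(** For 1 - cos (x s) in place of |x|^{2-a}, the quadratic form is
    (sum_j y_j (cos (t_{j+1} s) - cos (t_j s)))^2
    + (sum_j y_j (sin (t_{j+1} s) - sin (t_j s)))^2. *)
Lemma increments_powR_ge0 (m : nat) (t : nat -> R) (y : 'I_m -> R) :
  0 <= \sum_(j < m) \sum_(k < m) y j * y k * pow_incr t j k.
Proof.
(* The pair of booleans selects the ends of the cells j and k, that is, one of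
   the four terms of the mixed difference, with its sign. *)
pose c (i : ('I_m * 'I_m) * (bool * bool)) : R :=
  - (y i.1.1 * y i.1.2) * ((-1) ^+ i.2.1 * (-1) ^+ i.2.2).
pose x (i : ('I_m * 'I_m) * (bool * bool)) : R :=
  t (i.2.1 + i.1.1)%N - t (i.2.2 + i.1.2)%N.
have sumE (F : R -> R) : \sum_i c i * F (x i) =
    \sum_(j < m) \sum_(k < m) y j * y k *
    (F (t j.+1 - t k) + F (t j - t k.+1) - F (t j.+1 - t k.+1) - F (t j - t k)).
  rewrite -(pair_bigA _ (fun p q => c (p, q) * F (x (p, q))))/=.
  rewrite -(pair_bigA _ (fun j k => \sum_q c (j, k, q) * F (x (j, k, q))))/=.
  apply: eq_bigr => j _; apply: eq_bigr => k _.
  rewrite -(pair_bigA _ (fun p q => c (j, k, (p, q)) * F (x (j, k, (p, q)))))/=.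
  rewrite !big_bool /c /x /= !add0n !add1n; ring.
rewrite -(sumE (fun x => `|x| `^ (2 - a))).
apply: sum_normr_powR_ge0 => s s0.
rewrite (sumE (fun x => 1 - cos (x * s))).
rewrite (_ : \sum_(j < m) _ =
  (\sum_(j < m) y j * (cos (t j.+1 * s) - cos (t j * s))) ^+ 2 +
  (\sum_(j < m) y j * (sin (t j.+1 * s) - sin (t j * s))) ^+ 2).
  by rewrite addr_ge0 ?sqr_ge0.
rewrite !expr2 !mulr_suml -big_split/=; apply: eq_bigr => j _.
rewrite !mulr_sumr -big_split/=; apply: eq_bigr => k _.
rewrite !mulrBl !cosB; ring.
Qed.

Definition L1scale : R := (Gamma (1 - a) * (1 - a) * (2 - a))^-1.

Lemma L1scale_gt0 : 0 < L1scale.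
Proof.
have /andP[a0 a1] := a01.
rewrite invr_gt0 !mulr_gt0 ?subr_gt0//; last lra.
apply: Gamma_gt0; apply/andP; split; lra.
Qed.

(** The inner integral is a difference of powers 1 - a of v - t_k, and the
    outer one a difference of powers 2 - a. On the diagonal the domain s < v is
    half of the square cell, which is the origin of the factor 1/2. *)
Lemma L1p_coefE (t : nat -> R) (n k : nat) : (k <= n)%N ->
  (forall i j, (i < j)%N -> (j <= n.+1)%N -> t i < t j) ->
  L1p_coef a t n.+1 k.+1 =
  L1scale * (if k == n then 2^-1 else 1) * pow_incr t n k
    / (t n.+1 - t n) / (t k.+1 - t k).
Proof.
have /andP[a0 a1] := a01.
move=> kn incr.
have g1 : 0 < 1 - a by lra.
have g2 : 0 < 2 - a by lra.
have tn : t n < t n.+1 by exact: incr.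
have tk : t k < t k.+1 by apply: incr.
have tkn : t k <= t n.
  by move: kn; rewrite leq_eqVlt => /predU1P[->//|kn]; apply/ltW/incr.
have key : \int[mu]_(v in `[t n, t n.+1])
    \int[mu]_(s in `[t k, Num.min (t k.+1) v]) (v - s) `^ (- a) =
  (if k == n then 2^-1 else 1) * pow_incr t n k / (2 - a) / (1 - a).
  have E1 : - a = 1 - a - 1 by lra.
  have E2 : 1 - a = 2 - a - 1 by lra.
  have [->|kn'] := eqVneq k n.
    rewrite (@eq_Rintegral _ _ _ mu _ (fun v => (1 - a)^-1 * (v - t n) `^ (2 - a - 1))); last first.
      move=> v /set_mem/=; rewrite in_itv/= => /andP[v1 v2].
      rewrite min_r// [in LHS]E1 Rintegral_cc_powR_subr// subrr powR0 ?subr0 ?gt_eqF//.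
      by rewrite -E2 mulrC.
    rewrite RintegralZl//; last exact: integrable_cc_powR_subl.
    rewrite Rintegral_cc_powR_subl// subrr powR0 ?subr0 ?gt_eqF//.
    rewrite /pow_incr !subrr normr0 (distrC (t n)) ger0_norm ?subr_ge0 ?ltW//.
    rewrite powR0 ?gt_eqF//; field; lra.
  have {}kn : (k < n)%N by rewrite ltn_neqAle kn'.
  have tkn1 : t k.+1 <= t n.
    by move: kn; rewrite leq_eqVlt => /predU1P[->//|kn]; apply/ltW/incr.
  rewrite (@eq_Rintegral _ _ _ mu _ (fun v => (1 - a)^-1 * ((v - t k) `^ (2 - a - 1)
       - (v - t k.+1) `^ (2 - a - 1)))); last first.
    move=> v /set_mem/=; rewrite in_itv/= => /andP[v1 v2].
    have h : t k.+1 <= v by exact: le_trans v1.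
    by rewrite min_l// [in LHS]E1 (Rintegral_cc_powR_subr g1 h (ltW tk)) -E2 mulrC.
  rewrite RintegralZl//; last first.
    have I1 : mu.-integrable `[t n, t n.+1]
        (EFin \o (fun v => (v - t k) `^ (2 - a - 1))).
      exact: integrable_cc_powR_subl.
    have I2 : mu.-integrable `[t n, t n.+1]
        (EFin \o (fun v => (v - t k.+1) `^ (2 - a - 1))).
      exact: integrable_cc_powR_subl.
    exact: (integrableB _ I1 I2).
  rewrite RintegralB//; try exact: integrable_cc_powR_subl.
  rewrite !Rintegral_cc_powR_subl// mul1r /pow_incr.
  rewrite !ger0_norm ?subr_ge0//; lra.
rewrite /L1p_coef key /tau/= /L1scale.
have G0 : Gamma (1 - a) != 0 by rewrite gt_eqF// Gamma_gt0//; lra.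
field; rewrite G0; lra.
Qed.

Lemma pow_incrC t j k : pow_incr t j k = pow_incr t k j.
Proof.
rewrite /pow_incr (distrC (t j.+1) (t k)) (distrC (t j) (t k.+1)).
by rewrite (distrC (t j.+1)) (distrC (t j) (t k)); ring.
Qed.

Definition L1p_mx (t : nat -> R) (m : nat) : 'M[R]_m :=
  \matrix_(j, k) if (k <= j)%N then L1p_coef a t j.+1 k.+1 else 0.

(** The factor 1/2 on the diagonal makes the triangular form exactly half of
    the full symmetric form of [increments_powR_ge0], taken at x_j / tau_j. *)
Lemma L1p_mx_psd (t : nat -> R) (m : nat) (x : 'I_m -> R) :
  (forall i j, (i < j)%N -> (j <= m)%N -> t i < t j) ->
  0 <= \sum_(j < m) \sum_(k < m) L1p_mx t m j k * x j * x k.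
Proof.
move=> incr.
pose y (j : 'I_m) := x j / (t j.+1 - t j).
pose f (j k : 'I_m) := y j * y k * pow_incr t j k.
(* Adding w and its transpose gives the constant weight 1. *)
pose w (j k : 'I_m) : R := if (k <= j)%N then if k == j :> nat then 2^-1 else 1 else 0.
have -> : \sum_(j < m) \sum_(k < m) L1p_mx t m j k * x j * x k =
    L1scale * \sum_(j < m) \sum_(k < m) w j k * f j k.
  rewrite mulr_sumr; apply: eq_bigr => j _; rewrite mulr_sumr.
  apply: eq_bigr => k _; rewrite mxE /w; case: ifPn => [kj|_]; last by rewrite !mul0r mulr0.
  rewrite L1p_coefE//; last first.
    by move=> i l il lj; apply: incr => //; exact: leq_trans lj (ltn_ord j).
  rewrite /f /y; ring.
apply: mulr_ge0; first exact/ltW/L1scale_gt0.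
rewrite -(pmulr_rge0 _ (ltr0n R 2)) mulr2n mulrDl mul1r.
rewrite [X in _ + X]exchange_big/= -big_split/=.
suff -> : \sum_(i < m) (\sum_(k < m) w i k * f i k + \sum_(i0 < m) w i0 i * f i0 i) =
   \sum_(j < m) \sum_(k < m) f j k by exact: increments_powR_ge0.
apply: eq_bigr => j _; rewrite -big_split/=; apply: eq_bigr => k _.
have -> : f k j = f j k by rewrite /f pow_incrC; ring.
rewrite -mulrDl /w
  [X in _ + (if _ then X else _)](_ : _ = if k == j :> nat then 2^-1 else 1); last first.
  by rewrite eq_sym.
by case: ltngtP => _; lra.
Qed.

Lemma L1p_mx_diag_gt0 (t : nat -> R) (m : nat) (j : 'I_m) :
  (forall i j, (i < j)%N -> (j <= m)%N -> t i < t j) -> 0 < L1p_mx t m j j.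
Proof.
move=> incr; have tj : t j < t j.+1 by apply: incr.
rewrite mxE leqnn L1p_coefE//; last first.
  by move=> i l il lj; apply: incr => //; exact: leq_trans lj (ltn_ord j).
rewrite eqxx /pow_incr !subrr normr0 (distrC (t j)) powR0; last by have := a01; lra.
rewrite !divr_gt0 ?subr_gt0// !mulr_gt0 ?L1scale_gt0// !subr0.
by rewrite addr_gt0// powR_gt0// normr_gt0 subr_eq0 gt_eqF.
Qed.

Lemma L1p_mx_unit (t : nat -> R) (m : nat) :
  (forall i j, (i < j)%N -> (j <= m)%N -> t i < t j) -> L1p_mx t m \in unitmx.
Proof.
move=> incr; rewrite unitmxE det_trig.
  by rewrite unitfE prodf_seq_neq0; apply/allP => j _; rewrite gt_eqF// L1p_mx_diag_gt0.
by apply/is_trig_mxP => i j ij; rewrite mxE leqNgt ij.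
Qed.

(** With u = B^-1 g, the form of B^-1 at g is the form of B at u. *)
Lemma invmx_L1p_psd (t : nat -> R) (m : nat) (g : 'I_m -> R) :
  (forall i j, (i < j)%N -> (j <= m)%N -> t i < t j) ->
  0 <= \sum_(j < m) \sum_(k < m) invmx (L1p_mx t m) j k * g j * g k.
Proof.
move=> incr; set B := L1p_mx t m; set C := invmx B.
pose u j := \sum_(k < m) C j k * g k.
have gE j : g j = \sum_(k < m) B j k * u k.
  have /(congr1 (fun M : 'M[R]_m => \sum_(k < m) M j k * g k)) := esym (mulmxV (L1p_mx_unit incr)).
  rewrite (bigD1 j)//= mxE eqxx mul1r big1 ?addr0; last first.
    by move=> k kj; rewrite mxE eq_sym (negbTE kj) mul0r.
  under eq_bigr do rewrite mxE mulr_suml.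
  rewrite exchange_big /= => ->.
  apply: eq_bigr => k _; rewrite /u mulr_sumr; apply: eq_bigr => l _.
  by rewrite mulrA.
have -> : \sum_(j < m) \sum_(k < m) C j k * g j * g k =
    \sum_(j < m) \sum_(k < m) B j k * u j * u k.
  apply: eq_bigr => j _.
  transitivity (g j * u j).
    by rewrite /u mulr_sumr; apply: eq_bigr => k _; ring.
  by rewrite {1}gE mulr_suml; apply: eq_bigr => k _; ring.
exact: L1p_mx_psd.
Qed.

End L1plus.

(** * Borel sets of row vectors *)

Section BorelRowVectors.
Variables (R : realType) (d : nat).
Implicit Types U : set 'rV[R]_d.

Lemma rV_ballE (x y : 'rV[R]_d) (e : R) :
  0 < e -> ball x e y <-> forall i, `|x 0 i - y 0 i| < e.
Proof.
move=> e0; split=> [[_ h] i|h]; first exact: (h 0 i).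
by split => // i j; rewrite (ord1 i); exact: h.
Qed.

Lemma measurable_rV_ball (x : 'rV[R]_d) (e : R) :
  measurable [set y : 'rV[R]_d | forall i, `|x 0 i - y 0 i| < e].
Proof.
rewrite (_ : [set _ | _] = \bigcap_(i in [set: 'I_d])
    ((fun y : 'rV[R]_d => y 0 i) @^-1` [set s | `|x 0 i - s| < e])); last first.
  by rewrite predeqE => y; split => [h i _|h i]; [exact: h|exact: (h i)].
apply: fin_bigcap_measurable; first exact: finite_finset.
move=> i _; rewrite -[X in measurable X]setTI; apply: measurable_coord => //.
apply: open_measurable.
have -> : [set s | `|x 0 i - s| < e] = ball (x 0 i) e by [].
exact: ball_open.
Qed.

(** The sigma-algebra is generated by the coordinates: an open set is a
    countable union of balls with rational centre and radius, and balls of the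
    sup norm are products of intervals. *)
Lemma open_measurable_rV U : open U -> measurable U.
Proof.
move=> oU.
pose F (q : 'rV[rat]_d * rat) : set 'rV[R]_d :=
  [set y | forall i, `|ratr (q.1 0 i) - y 0 i| < ratr q.2].
have -> : U = \bigcup_(q in [set q | F q `<=` U]) F q.
  rewrite predeqE => x; split => [Ux|[q /= + Fqx]]; last exact.
  have /nbhs_ballP[e /= e0 eU] := open_nbhs_nbhs (conj oU Ux).
  have [r] := rat_in_itvoo (divr_gt0 e0 (ltr0n R 2)).
  rewrite in_itv/= => /andP[r0 re].
  have /choice[q qP] : forall i, exists q : rat, `|ratr q - x 0 i| < ratr r.
    move=> i; have h : x 0 i < x 0 i + ratr r by rewrite ltrDl.
    have [q] := rat_in_itvoo h; rewrite in_itv/= => /andP[q1 q2].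
    by exists q; rewrite gtr0_norm ?subr_gt0// ltrBlDl.
  exists (\row_i q i, r) => /=; last by move=> i; rewrite mxE; exact: qP.
  move=> y yF; apply: eU; apply/rV_ballE => // i.
  have := yF i; rewrite mxE => h1; have h2 := qP i.
  apply: le_lt_trans (ler_distD (ratr (q i)) _ _) _.
  rewrite distrC; lra.
rewrite bigcup_mkcond; apply: countable_bigcupT_measurable => [|q].
  exact: countableP.
case: ifP => _; last exact: measurable0.
have := measurable_rV_ball (map_mx ratr q.1) (ratr q.2).
by congr measurable; rewrite predeqE => y; split => h i; have := h i; rewrite mxE.
Qed.

Lemma continuous_on_measurable_fun U (f : 'rV[R]_d -> R) : open U ->
  (forall x, U x -> {for x, continuous f}) ->
  measurable_fun U (f : 'rV[R]_d -> measurableTypeR R).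
Proof.
move=> oU cf; apply: (measurability _ (RGenOpens.measurableE R)).
move=> _ [_ [a [b ->]] <-]; apply: open_measurable_rV.
rewrite openE => x [Ux fx]; apply: filterI; first exact: open_nbhs_nbhs.
by apply: (cf x Ux); exact: open_nbhs_nbhs.
Qed.

End BorelRowVectors.

(** * Lebesgue measure of boxes *)

Section LebesgueBoxes.
Variable R : realType.
Local Notation mu := (@lebesgue_measure R).

Lemma rV_cons0 d (p : 'rV[R]_d * measurableTypeR R) : rV_cons p 0 ord0 = p.2.
Proof. by rewrite mxE unlift_none. Qed.

Lemma rV_consS d (p : 'rV[R]_d * measurableTypeR R) j :
  rV_cons p 0 (lift ord0 j) = p.1 0 j.
Proof. by rewrite mxE liftK. Qed.

Definition rV_tail d (x : 'rV[R]_d.+1) : 'rV[R]_d := \row_j x 0 (lift ord0 j).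

Lemma preimage_rV_cons_box d (a b : 'rV[R]_d.+1) :
  @rV_cons R d @^-1` open_box a b =
  open_box (rV_tail a) (rV_tail b) `*` `]a 0 ord0, b 0 ord0[%classic.
Proof.
rewrite predeqE => -[x s]; split => [h|[h1 h2] i].
  split => /=; last by have := h ord0; rewrite rV_cons0 in_itv.
  by move=> j; have := h (lift ord0 j); rewrite rV_consS !mxE.
case: (unliftP ord0 i) => [j ->|->].
  by rewrite rV_consS; have := h1 j; rewrite !mxE.
by rewrite rV_cons0; move: h2; rewrite /= in_itv.
Qed.

Lemma measurable_open_box d (a b : 'rV[R]_d) : measurable (open_box a b).
Proof.
rewrite (_ : open_box a b = \bigcap_(i in [set: 'I_d])
    ((fun y : 'rV[R]_d => y 0 i) @^-1` `]a 0 i, b 0 i[%classic)); last first.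
  rewrite predeqE => y; split => [h i _|h i].
    by rewrite /= in_itv; exact: h.
  by have := h i Logic.I; rewrite /= in_itv.
apply: fin_bigcap_measurable; first exact: finite_finset.
by move=> i _; rewrite -[X in measurable X]setTI; apply: measurable_coord.
Qed.

Lemma lebS d (A : set 'rV[R]_d.+1) :
  leb R d.+1 A = (leb R d \x mu)%E (@rV_cons R d @^-1` A).
Proof. by []. Qed.

Lemma leb_open_box_lty d (a b : 'rV[R]_d) : (leb R d (open_box a b) < +oo)%E.
Proof.
elim: d a b => [|d IH] a b.
  by rewrite /= diracE ltry.
rewrite lebS preimage_rV_cons_box.
rewrite product_measure1E//; last exact: measurable_open_box.
rewrite lte_mul_pinfty ?measure_ge0//.
  by rewrite ge0_fin_numE.
suff : (mu `](a 0%R ord0), (b 0%R ord0)[%classic < +oo)%E by [].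
by rewrite lebesgue_measure_itv/=; case: ifP => _; rewrite ?ltry// -EFinB ltry.
Qed.

Lemma leb_sigma_finite d : sigma_finite setT (leb R d).
Proof.
exists (fun n => open_box (const_mx (- n%:R)) (const_mx n%:R)).
  rewrite predeqE => x; split => // _.
  have [n hn] : exists n : nat, forall i, `|x 0 i| < n%:R.
    exists (Num.trunc (\sum_i `|x 0 i|)).+1 => i.
    apply: le_lt_trans (truncnS_gt _); rewrite (bigD1 i)//=.
    by rewrite lerDl sumr_ge0.
  by exists n => // i; rewrite !mxE; have := hn i; rewrite ltr_norml.
move=> n; split; [exact: measurable_open_box|exact: leb_open_box_lty].
Qed.

(** A copy of [leb] that carries the structure of a sigma-finite measure, as
    Fubini's theorem demands of both factors. *)
Definition lebf d (A : set 'rV[R]_d) : \bar R := leb R d A.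
Arguments lebf : clear implicits.

HB.instance Definition _ d := Measure.on (lebf d).
HB.instance Definition _ d := Measure_isSigmaFinite.Build _ _ _ (lebf d) (@leb_sigma_finite d).

End LebesgueBoxes.

(** * Continuous functions on bounded sets *)

Section ContinuousIntegrable.
Variables (R : realType) (d : nat).
Implicit Types Omega U : set 'rV[R]_d.

Lemma normr_coord_le (x : 'rV[R]_d) i : `|x 0 i| <= `|x|.
Proof.
rewrite -[leRHS]/(mx_norm x) mx_normrE.
exact: (le_bigmax _ (fun ij : 'I_1 * 'I_d => `|x ij.1 ij.2|) (0, i)).
Qed.

Lemma compact_closed_cube (K : R) :
  compact [set x : 'rV[R]_d | forall i, `[- K, K]%classic (x 0 i)].
Proof.
apply: (@rV_compact _ _ (fun=> `[- K, K]%classic)).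
by move=> _; exact: segment_compact.
Qed.

Lemma bounded_set_coord Omega : bounded_set Omega ->
  exists K : R, Omega `<=` [set x | forall i, `[- K, K]%classic (x 0 i)].
Proof.
move=> [M [Mr hM]]; exists (`|M| + 1) => x Ox i.
have hK : M < `|M| + 1 by rewrite (le_lt_trans (ler_norm M))// ltrDl.
have := hM _ hK x Ox; rewrite /= in_itv/= -ler_norml; apply: le_trans.
exact: normr_coord_le.
Qed.

Lemma bounded_set_leb_lty Omega : measurable Omega -> bounded_set Omega ->
  (leb R d Omega < +oo)%E.
Proof.
move=> mO /bounded_set_coord[K OK].
apply: (@le_lt_trans _ _
  (leb R d (open_box (const_mx (- (K + 1))) (const_mx (K + 1))))); last first.
  exact: leb_open_box_lty.
apply: le_measure; rewrite ?inE//; first exact: measurable_open_box.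
by move=> x /OK Ox i; have := Ox i; rewrite !mxE /= in_itv/=; lra.
Qed.

Lemma compact_closure Omega : bounded_set Omega -> compact (closure Omega).
Proof.
move=> /bounded_set_coord[K OK]; have cK := @compact_closed_cube K.
apply: (subclosed_compact (@closed_closure _ _) cK).
rewrite [X in _ `<=` X](closure_id _).1; first exact: closureS.
by apply: compact_closed cK; exact: norm_hausdorff.
Qed.

Lemma continuous_on_bounded Omega U (f : 'rV[R]_d -> R) :
  bounded_set Omega -> closure Omega `<=` U ->
  (forall x, U x -> {for x, continuous f}) ->
  [bounded f x | x in Omega].
Proof.
move=> bO OU cf.
have /compact_bounded[M [Mr hM]] : compact (f @` closure Omega).
  apply: continuous_compact; last exact: compact_closure.
  by apply: continuous_in_subspaceT => x /set_mem /OU; exact: cf.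
exists M; split => // K MK x Ox; apply: (hM K MK).
by exists x => //; exact: subset_closure.
Qed.

Lemma continuous_on_integrable Omega U (f : 'rV[R]_d -> R) :
  measurable Omega -> bounded_set Omega -> open U -> closure Omega `<=` U ->
  (forall x, U x -> {for x, continuous f}) ->
  (leb R d).-integrable Omega (EFin \o f).
Proof.
move=> mO bO oU OU cf; apply: measurable_bounded_integrable => //.
- exact: bounded_set_leb_lty.
- apply: measurable_funS (open_measurable_rV oU) _ _.
    by apply: subset_trans OU; exact: subset_closure.
  exact: continuous_on_measurable_fun.
- exact: continuous_on_bounded bO OU cf.
Qed.

End ContinuousIntegrable.

(** * Periodic derivatives integrate to zero over a cell *)

Section BoxFubini.
Variable R : realType.
Local Notation mu := (@lebesgue_measure R).

Lemma bounded_open_box d (a b : 'rV[R]_d) : bounded_set (open_box a b).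
Proof.
exists (\sum_i (`|a 0 i| + `|b 0 i|)); split; first exact: num_real.
move=> K hK x xab; apply: le_trans (ltW hK).
rewrite -[leLHS]/(mx_norm x) mx_normrE; apply: bigmax_le.
  by apply: sumr_ge0 => i _; rewrite addr_ge0.
move=> [i j] _ /=; rewrite (ord1 i) (bigD1 j)//=.
have h : 0 <= \sum_(i0 < d | i0 != j) (`|a 0 i0| + `|b 0 i0|).
  by apply: sumr_ge0 => k _; rewrite addr_ge0.
have /andP[h1 h2] := xab j.
have := ler_norm (b 0 j); have := ler_norm (- a 0 j); rewrite normrN => *.
by rewrite ler_norml; apply/andP; split; have := normr_ge0 (a 0 j); have := normr_ge0 (b 0 j); lra.
Qed.

Lemma continuous_rV (T : topologicalType) d (f : T -> 'rV[R]_d) :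
  (forall i, continuous (fun x => f x 0 i)) -> continuous f.
Proof.
move=> cf x; apply/cvg_ballP => e e0; near=> y; apply/rV_ballE => //.
near: y; apply: filter_forall => i.
by have /cvgrPdist_lt := cf i x; apply.
Unshelve. all: by end_near. Qed.

Lemma continuous_rV_cons1 d (s : R) :
  continuous (fun x : 'rV[R]_d => rV_cons (x, s : measurableTypeR R)).
Proof.
apply: continuous_rV => i; case: (unliftP ord0 i) => [j|] ->.
  under eq_fun do rewrite rV_consS.
  exact: coord_continuous.
by under eq_fun do rewrite rV_cons0; exact: cst_continuous.
Qed.

Definition rV_set d (x : 'rV[R]_d) (i : 'I_d) (s : R) : 'rV[R]_d :=
  \row_j if j == i then s else x 0 j.

(** Coordinate 0 is the factor that the recursive construction of [leb] adds
    last, hence the only one that can be integrated separately in one step. *)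
Lemma box_Fubini d (a b : 'rV[R]_d.+1) (f : 'rV[R]_d.+1 -> R) : continuous f ->
  let F p := (f (rV_cons p))%:E in
  let A := open_box (rV_tail a) (rV_tail b) in
  let B := `]a 0 ord0, b 0 ord0[%classic : set (measurableTypeR R) in
  (\int[leb R d.+1]_(y in open_box a b) (f y)%:E =
   \int[leb R d]_(x in A) \int[mu]_(s in B) F (x, s))%E /\
  (\int[leb R d.+1]_(y in open_box a b) (f y)%:E =
   \int[mu]_(s in B) \int[leb R d]_(x in A) F (x, s))%E.
Proof.
move=> cf F A B.
have mf : measurable_fun setT (f : _ -> measurableTypeR R).
  by apply: continuous_on_measurable_fun; [exact: openT|move=> x _; exact: cf].
have mA : measurable A by exact: measurable_open_box.
have mB : measurable B by exact: measurable_itv.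
have mAB : measurable (A `*` B) by exact: measurableX.
have mFT : measurable_fun setT (f \o @rV_cons R d).
  by apply: measurableT_comp mf _; exact: measurable_rV_cons.
have iF : (leb R d \x mu)%E.-integrable (A `*` B) F.
  apply: measurable_bounded_integrable => //.
  - have := leb_open_box_lty a b.
    by rewrite lebS preimage_rV_cons_box.
  - exact: measurable_funTS.
  - have [M [Mr hM]] := continuous_on_bounded (bounded_open_box a b)
      (@subsetT _ _) (fun x _ => cf x).
    exists M; split => // K MK p Ap; apply: (hM K MK).
    by rewrite -/(open_box a b) -[open_box a b _]/((@rV_cons R d @^-1` open_box a b) p)
      preimage_rV_cons_box.
pose G : 'rV[R]_d * measurableTypeR R -> \bar R := F \_ (A `*` B).
have iG : (@lebf R d \x mu)%E.-integrable setT G.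
  by apply/(integrable_mkcond _ mAB).
have E0 : (\int[leb R d.+1]_(y in open_box a b) (f y)%:E =
           \int[@lebf R d \x mu]_p G p)%E.
  rewrite /G -integral_mkcond.
  have := @integral_pushforward _ _ _ _ R (@rV_cons R d) (@measurable_rV_cons R d)
    (leb R d \x mu)%E (open_box a b) (EFin \o f).
  rewrite preimage_rV_cons_box; apply => //.
  - exact/measurable_EFinP.
  - exact: measurable_open_box.
have in_AB x s : ((x, s) \in A `*` B) = (x \in A) && (s \in B).
  by apply/idP/andP => [/set_mem[/mem_set ? /mem_set ?]|[/set_mem ? /set_mem ?]];
    [split|apply/mem_set].
rewrite E0; split.
  rewrite -(integral12_prod_meas1 iG) [RHS]integral_mkcond.
  apply: eq_integral => x _; rewrite /fubini_F patchE; case: ifPn => xA.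
    rewrite [RHS]integral_mkcond; apply: eq_integral => s _.
    by rewrite /G !patchE in_AB xA.
  by apply: integral0_eq => s _; rewrite /G patchE in_AB (negbTE xA).
rewrite -(integral21_prod_meas1 iG) [RHS]integral_mkcond.
apply: eq_integral => s _; rewrite /fubini_G patchE; case: ifPn => sB.
  rewrite [RHS]integral_mkcond; apply: eq_integral => x _.
  by rewrite /G !patchE in_AB sB andbT.
by apply: integral0_eq => x _; rewrite /G patchE in_AB (negbTE sB) andbF.
Qed.

(** A direction i > 0 is reached by integrating first over the last d
    coordinates and using the induction hypothesis there. *)
Lemma integral_box_line0 d (i : 'I_d) (a b : 'rV[R]_d) (f : 'rV[R]_d -> R) :
  continuous f ->
  (forall x, \int[mu]_(s in `](a 0 i)%R, (b 0 i)%R[) (f (rV_set x i s))%:E = 0)%E ->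
  (\int[leb R d]_(y in open_box a b) (f y)%:E = 0)%E.
Proof.
elim: d i a b f => [[]//|d IH] i a b f cf line0.
have [F1 F2] := box_Fubini a b cf.
case: (unliftP ord0 i) => [j|] ij.
  rewrite F2; apply: integral0_eq => s _.
  apply: (IH j _ _ (fun x => f (rV_cons (x, s)))).
    move=> x; apply: (@continuous_comp _ _ _ (fun x => rV_cons (x, s)) f).
      exact: continuous_rV_cons1.
    exact: cf.
  move=> x; rewrite !mxE -ij -[RHS](line0 (rV_cons (x, s))).
  apply: eq_integral => u _; congr (f _)%:E; apply/rowP => k; rewrite [RHS]mxE ij.
  case: (unliftP ord0 k) => [l|] ->; last by rewrite !rV_cons0.
  by rewrite !rV_consS mxE (inj_eq (@lift_inj _ ord0)).
rewrite F1; apply: integral0_eq => x _.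
rewrite -[RHS](line0 (rV_cons (x, 0))) ij.
apply: eq_integral => u _; congr (f _)%:E; apply/rowP => k; rewrite [RHS]mxE.
case: (unliftP ord0 k) => [l|] ->; last by rewrite !rV_cons0 eqxx.
by rewrite !rV_consS eq_sym (negbTE (neq_lift _ _)).
Qed.

Lemma continuous_rV_set d (x : 'rV[R]_d) (i : 'I_d) : continuous (rV_set x i).
Proof.
apply: continuous_rV => j; under eq_fun do rewrite mxE.
case: (j == i); first by move=> ?; exact: cvg_id.
exact: cst_continuous.
Qed.

(** Moving the coordinate i of x is moving along the i-th basis vector: the
    two difference quotients coincide. *)
Lemma is_derive_rV_set d (F : 'rV[R]_d -> R) (x : 'rV[R]_d) (i : 'I_d) (s : R) :
  derivable F (rV_set x i s) (delta_mx 0 i) ->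
  is_derive s 1 (fun u => F (rV_set x i u)) (partial i F (rV_set x i s)).
Proof.
have E : (fun h : R => h^-1 *: (F (rV_set x i (h *: 1 + s)) - F (rV_set x i s))) =
  (fun h => h^-1 *: (F (h *: delta_mx 0 i + rV_set x i s) - F (rV_set x i s))).
  apply/funext => h; congr (_ *: (F _ - _)); apply/rowP => j; rewrite !mxE /=.
  case: (j == i); first by rewrite /= -[h *: 1]/(h * 1).
  by rewrite mulr0 add0r.
move=> dF; split; first by rewrite /derivable E.
by rewrite /partial /derive E.
Qed.

Lemma integral_box_partial_periodic d (a b : 'rV[R]_d) (i : 'I_d)
    (F : 'rV[R]_d -> R) : a 0 i < b 0 i -> C1_on setT F ->
  (forall x, F (x + (b 0 i - a 0 i) *: delta_mx 0 i) = F x) ->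
  (\int[leb R d]_(y in open_box a b) (partial i F y)%:E = 0)%E.
Proof.
move=> ab cF pF; apply: (@integral_box_line0 _ i).
  by move=> x; have [_ /(_ i)[_]] := cF x Logic.I.
move=> x.
have cp : continuous (fun s : R => partial i F (rV_set x i s)).
  move=> s; apply: (@continuous_comp _ _ _ (rV_set x i) (partial i F)).
    exact: continuous_rV_set.
  by have [_ /(_ i)[_]] := cF (rV_set x i s) Logic.I.
have dF (s : R) : is_derive s 1 (fun u => F (rV_set x i u)) (partial i F (rV_set x i s)).
  by apply: is_derive_rV_set; have [_ /(_ i)[]] := cF (rV_set x i s) Logic.I.
have cg (s : R) : {for s, continuous (fun u => F (rV_set x i u))}.
  by apply: differentiable_continuous; apply/derivable1_diffP; apply: ex_derive.
rewrite -(integral_itv_bndoo true false); last first.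
  by apply/measurable_EFinP; apply: measurable_funTS; exact: continuous_measurable_fun.
rewrite (@continuous_FTC2 _ _ (fun u => F (rV_set x i u)))//.
- rewrite -EFinB (_ : rV_set x i (b 0 i) =
    rV_set x i (a 0 i) + (b 0 i - a 0 i) *: delta_mx 0 i) ?pF ?subrr//.
  apply/rowP => j; rewrite !mxE /=; case: (j == i); last by rewrite mulr0 addr0.
  by rewrite mulr1 addrC subrK.
- exact: continuous_subspaceT.
- split; first by move=> s _; exact: ex_derive.
  + exact/cvg_at_right_filter/cg.
  + exact/cvg_at_left_filter/cg.
- by move=> s _; rewrite derive1E; exact: derive_val.
Qed.

End BoxFubini.

(** * Green's identity *)

Section Calculus.
Variables (R : realType) (d : nat).
Implicit Types (f g : 'rV[R]_d -> R) (U Omega : set 'rV[R]_d).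

(** The divergence of f grad g, expanded. *)
Definition green f g x : R :=
  \sum_(i < d) partial i f x * partial i g x + f x * laplacian g x.

(** The part of the Neumann condition that concerns smoothness. The
    neighbourhood of the closure may depend on f. *)
Definition regular Omega f : Prop :=
  exists U, [/\ open U, closure Omega `<=` U & C2_on U f].

Lemma C1_onS U V f : V `<=` U -> C1_on U f -> C1_on V f.
Proof. by move=> VU cf x /VU; exact: cf. Qed.

Lemma C2_onS U V f : V `<=` U -> C2_on U f -> C2_on V f.
Proof.
by move=> VU [cf ci]; split => [|i]; [exact: C1_onS cf|exact: C1_onS (ci i)].
Qed.

Lemma near_eq_continuous U f g x : open U -> U x -> (forall y, U y -> f y = g y) ->
  {for x, continuous g} -> {for x, continuous f}.
Proof.
move=> oU Ux fg cg; rewrite /prop_for /continuous_at (fg x)//.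
apply: cvg_trans cg; apply: (@near_eq_cvg _ _ (nbhs x)).
apply: (@filterS _ (nbhs x) _ U); last exact: open_nbhs_nbhs.
by move=> y Uy; rewrite fg.
Qed.

Lemma partialM U f g i x : C1_on U f -> C1_on U g -> U x ->
  partial i (fun y => f y * g y) x = f x * partial i g x + g x * partial i f x.
Proof.
move=> cf cg Ux; have [_ /(_ i)[df _]] := cf x Ux.
by have [_ /(_ i)[dg _]] := cg x Ux; rewrite /partial (deriveM df dg).
Qed.

Lemma C1_onM U f g : open U -> C1_on U f -> C1_on U g ->
  C1_on U (fun y => f y * g y).
Proof.
move=> oU cf cg x Ux.
have [cfx dfx] := cf x Ux; have [cgx dgx] := cg x Ux.
split; first exact: (continuousM cfx cgx).
move=> i; have [df cdf] := dfx i; have [dg cdg] := dgx i.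
split; first exact: (derivableM df dg).
apply: (@near_eq_continuous U _ (fun x => f x * partial i g x + g x * partial i f x)) => //.
  by move=> y Uy; exact: (partialM i cf cg Uy).
exact: (continuousD (continuousM cfx cdg) (continuousM cgx cdf)).
Qed.

Lemma continuous_on_sum (I : Type) (r : seq I) (F : I -> 'rV[R]_d -> R) x :
  (forall i, {for x, continuous (F i)}) ->
  {for x, continuous (fun y => \sum_(i <- r) F i y)}.
Proof.
move=> cF; elim: r => [|i r IH].
  have -> : (fun y => \sum_(i <- [::]) F i y) = cst 0.
    by apply/funext => y; rewrite big_nil.
  exact: cst_continuous.
have -> : (fun y => \sum_(j <- i :: r) F j y) =
    (fun y => F i y + \sum_(j <- r) F j y).
  by apply/funext => y; rewrite big_cons.
exact: (continuousD (cF i) IH).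
Qed.

Lemma continuous_green U f g x : C1_on U f -> C2_on U g -> U x ->
  {for x, continuous (green f g)}.
Proof.
move=> cf [cg cdg] Ux; have [cfx dfx] := cf x Ux; have [cgx dgx] := cg x Ux.
apply: continuousD.
  by apply: continuous_on_sum => i; apply: continuousM; [exact: (dfx i).2|exact: (dgx i).2].
apply: continuousM => //; apply: continuous_on_sum => i.
by have [_ /(_ i)[]] := cdg i x Ux.
Qed.

Lemma green_divergence U f g x : C1_on U f -> C2_on U g -> U x ->
  green f g x = \sum_(i < d) partial i (fun y => f y * partial i g y) x.
Proof.
move=> cf [cg cdg] Ux; rewrite /green mulr_sumr -big_split/=.
apply: eq_bigr => i _; rewrite (partialM i cf (cdg i) Ux) addrC mulrC.
by congr (_ + _); rewrite mulrC.
Qed.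

Lemma integrable_green Omega f g : measurable Omega -> bounded_set Omega ->
  regular Omega f -> regular Omega g ->
  (leb R d).-integrable Omega (EFin \o green f g).
Proof.
move=> mO bO [U [oU OU cf]] [V [oV OV cg]].
apply: (@continuous_on_integrable _ _ _ (U `&` V)) => //.
- exact: openI.
- by move=> x Ox; split; [exact: OU|exact: OV].
- move=> x UVx; apply: (@continuous_green (U `&` V)) => //.
    by apply: C1_onS cf.1; exact: subIsetl.
  by apply: C2_onS cg; exact: subIsetr.
Qed.

Lemma partial_periodic i f (v : 'rV[R]_d) : (forall x, f (x + v) = f x) ->
  forall x, partial i f (x + v) = partial i f x.
Proof.
move=> fv x; rewrite /partial /derive; congr (lim (_ @ 0^')).
by apply/funext => h; rewrite /= addrA !fv.
Qed.

(** Each f d_i g is periodic, so its derivative in direction i has zero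
    integral along each line of that direction. *)
Lemma integral_green_periodic (a b : 'rV[R]_d) f g :
  (forall i, a 0 i < b 0 i) -> periodic_bc a b f -> periodic_bc a b g ->
  \int[leb R d]_(x in open_box a b) green f g x = 0.
Proof.
move=> ab [cf pf] [cg pg].
have cF i : C1_on setT (fun y => f y * partial i g y).
  by apply: C1_onM; [exact: openT|exact: cf.1|exact: cg.2].
have mO := measurable_open_box a b; have bO := bounded_open_box a b.
rewrite (@eq_Rintegral _ _ _ (leb R d) _
  (fun x => \sum_(i < d) partial i (fun y => f y * partial i g y) x)); last first.
  by move=> x _; apply: (@green_divergence setT) => //; exact: cf.1.
rewrite Rintegral_sum//; last first.
  move=> i; apply: (@continuous_on_integrable _ _ _ setT) => //; first exact: openT.
  by move=> x _; have [_ /(_ i)[]] := cF i x Logic.I.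
apply: big1 => i _; rewrite /Rintegral integral_box_partial_periodic//.
by move=> x; rewrite pf (partial_periodic _ (pg i)).
Qed.

(** The boundary term is f times the normal derivative of g. *)
Lemma integral_green_neumann Omega
    (sigma : {finite_measure set 'rV[R]_d -> \bar R})
    (nu : 'rV[R]_d -> 'rV[R]_d) f g :
  open Omega -> finite_perimeter Omega sigma nu ->
  regular Omega f -> neumann_bc Omega sigma nu g ->
  \int[leb R d]_(x in Omega) green f g x = 0.
Proof.
move=> oO [_ mnu _ gg] [U [oU OU cf]] [[V [oV OV cg]] aeg].
pose W := U `&` V; have oW : open W by exact: openI.
have OW : closure Omega `<=` W.
  by move=> x Ox; split; [exact: OU|exact: OV].
have {}cf : C1_on W f by apply: C1_onS cf.1; exact: subIsetl.
have {}cg : C2_on W g by apply: C2_onS cg; exact: subIsetr.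
have cF i : C1_on W (fun y => f y * partial i g y).
  by apply: C1_onM => //; exact: cg.2.
rewrite (@eq_Rintegral _ _ _ (leb R d) _
  (fun x => \sum_(i < d) partial i (fun y => f y * partial i g y) x)); last first.
  move=> x /set_mem Ox; apply: (@green_divergence W) => //.
  exact/OW/subset_closure.
rewrite (gg W)//.
have mB : measurable (boundary Omega).
  apply: measurableD; last by apply: open_measurable_rV; exact: open_interior.
  rewrite -[closure _]setCK; apply: measurableC; apply: open_measurable_rV.
  by apply: closed_openC; exact: closed_closure.
have BW : boundary Omega `<=` W by move=> x [/OW].
rewrite /Rintegral (ae_eq_integral (cst 0%E))//; first by rewrite integral0.
- apply/measurable_EFinP; apply: measurable_sum => i; apply: measurable_funM.
    apply: measurable_funS BW _; first exact: open_measurable_rV.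
    by apply: continuous_on_measurable_fun => // x Wx; have [] := cF i x Wx.
  apply: measurable_funTS.
  exact: (measurableT_comp (@measurable_coord R d i) mnu).
- apply: filterS aeg => x nug _; congr EFin.
  under eq_bigr do rewrite -mulrA.
  by rewrite -mulr_sumr nug mulr0.
Qed.

End Calculus.

(** * The Laplacian of a mean *)

Section Midpoint.
Variables (R : realType) (d : nat).
Implicit Types (f g : 'rV[R]_d -> R) (U : set 'rV[R]_d).

Lemma partial_mean U f g i x : C1_on U f -> C1_on U g -> U x ->
  partial i (fun y => (f y + g y) / 2) x = (partial i f x + partial i g x) / 2.
Proof.
move=> cf cg Ux; have [_ /(_ i)[df _]] := cf x Ux.
have [_ /(_ i)[dg _]] := cg x Ux; rewrite /partial.
have -> : (fun y => (f y + g y) / 2) = 2^-1 *: (f + g).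
  by apply/funext => y; rewrite mulrC.
by rewrite (deriveZ _ (derivableD df dg)) (deriveD df dg) mulrC.
Qed.

(** The formula for the first derivatives of a mean holds on an open set
    only; this locality lets it be differentiated once more. *)
Lemma eq_partial U f g i x : open U -> U x -> (forall y, U y -> f y = g y) ->
  partial i f x = partial i g x.
Proof.
move=> oU Ux fg; apply: near_eq_derive.
apply: (@filterS _ (nbhs x) _ U); last exact: open_nbhs_nbhs.
by move=> y Uy; rewrite fg.
Qed.

Lemma laplacian_mean U f g x : open U -> C2_on U f -> C2_on U g -> U x ->
  laplacian (fun y => (f y + g y) / 2) x = (laplacian f x + laplacian g x) / 2.
Proof.
move=> oU [cf df] [cg dg] Ux.
rewrite /laplacian -big_split/= mulr_suml; apply: eq_bigr => i _.
rewrite -(partial_mean i (df i) (dg i) Ux).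
by apply: eq_partial oU Ux _ => y Uy; exact: (partial_mean i cf cg Uy).
Qed.

End Midpoint.

(** * Integrability up to the boundary *)

Section IntegrableClasses.
Variables (R : realType) (d : nat) (Omega : set 'rV[R]_d).
Hypotheses (mO : measurable Omega) (bO : bounded_set Omega).
Implicit Types f g h : 'rV[R]_d -> R.

(** The values of r are prescribed on Omega alone, so a function is allowed to
    differ outside Omega from the one that is continuous near the closure. *)
Definition cont_closure h : Prop := exists U h',
  [/\ open U, closure Omega `<=` U, forall x, U x -> {for x, continuous h'}
    & forall x, Omega x -> h x = h' x].

Lemma cont_closure_integrable h : cont_closure h ->
  (leb R d).-integrable Omega (EFin \o h).
Proof.
move=> [U [h' [oU OU ch hh']]].
apply: (eq_integrable mO (EFin \o h')).
  by move=> x /set_mem Ox; rewrite /= hh'.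
exact: continuous_on_integrable ch.
Qed.

Lemma cont_closure_eq f g : (forall x, Omega x -> f x = g x) ->
  cont_closure g -> cont_closure f.
Proof.
move=> fg [U [h' [oU OU ch gh]]]; exists U, h'; split => // x Ox.
by rewrite fg// gh.
Qed.

Lemma cont_closure_cst (c : R) : cont_closure (cst c).
Proof.
by exists setT, (cst c); split => //; [exact: openT|move=> x _; exact: cst_continuous].
Qed.

Lemma cont_closureD f g : cont_closure f -> cont_closure g ->
  cont_closure (fun x => f x + g x).
Proof.
move=> [U [f' [oU OU cf ff']]] [V [g' [oV OV cg gg']]].
exists (U `&` V), (fun x => f' x + g' x); split.
- exact: openI.
- by move=> x Ox; split; [exact: OU|exact: OV].
- by move=> x [Ux Vx]; exact: (continuousD (cf x Ux) (cg x Vx)).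
- by move=> x Ox; rewrite ff' ?gg'.
Qed.

Lemma cont_closureM f g : cont_closure f -> cont_closure g ->
  cont_closure (fun x => f x * g x).
Proof.
move=> [U [f' [oU OU cf ff']]] [V [g' [oV OV cg gg']]].
exists (U `&` V), (fun x => f' x * g' x); split.
- exact: openI.
- by move=> x Ox; split; [exact: OU|exact: OV].
- by move=> x [Ux Vx]; exact: (continuousM (cf x Ux) (cg x Vx)).
- by move=> x Ox; rewrite ff' ?gg'.
Qed.

Lemma cont_closureN f : cont_closure f -> cont_closure (fun x => - f x).
Proof.
move=> cf; apply: (cont_closure_eq (g := fun x => cst (-1) x * f x)).
  by move=> x _; rewrite mulN1r.
by apply: cont_closureM => //; exact: cont_closure_cst.
Qed.

Lemma cont_closure_sqr f : cont_closure f -> cont_closure (fun x => f x ^+ 2).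
Proof.
move=> cf; apply: (cont_closure_eq (g := fun x => f x * f x)).
  by move=> x _; rewrite expr2.
exact: cont_closureM.
Qed.

Lemma regular_cont_closure f : regular Omega f -> cont_closure f.
Proof.
by move=> [U [oU OU [cf _]]]; exists U, f; split => // x Ux; have [] := cf x Ux.
Qed.

Lemma grad_cont_closure f : regular Omega f -> cont_closure (grad_normsq f).
Proof.
move=> [U [oU OU [cf _]]]; exists U, (grad_normsq f); split => // x Ux.
apply: continuous_on_sum => i; have [_ /(_ i)[_ ci]] := cf x Ux.
exact: (continuousM ci ci).
Qed.

Definition null_integral h : Prop :=
  (leb R d).-integrable Omega (EFin \o h) /\ \int[leb R d]_(x in Omega) h x = 0.

Lemma null_integralD f g : null_integral f -> null_integral g ->
  null_integral (fun x => f x + g x).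
Proof.
move=> [fi f0] [gi g0]; split; first exact: (integrableD mO fi gi).
by rewrite RintegralD// f0 g0 addr0.
Qed.

Lemma null_integralZ (c : R) f : null_integral f ->
  null_integral (fun x => c * f x).
Proof.
move=> [fi f0]; split; first exact: integrable_scale.
by rewrite RintegralZl// f0 mulr0.
Qed.

Lemma null_integral_sum (I : Type) (s : seq I) (F : I -> 'rV[R]_d -> R) :
  (forall i, null_integral (F i)) ->
  null_integral (fun x => \sum_(i <- s) F i x).
Proof.
move=> F0; split; first by apply: integrable_sumr => // i; exact: (F0 i).1.
rewrite Rintegral_sum//; last by move=> i; exact: (F0 i).1.
by apply: big1 => i _; exact: (F0 i).2.
Qed.

End IntegrableClasses.

(** * Dissipation of the modified energy *)

Section Dissipation.
Variables (R : realType) (d : nat) (Omega : set 'rV[R]_d).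
Hypotheses (mO : measurable Omega) (bO : bounded_set Omega).
Variables (alpha eps M S : R) (t : nat -> R) (phi mu r : nat -> 'rV[R]_d -> R).
Variable m : nat.
Hypotheses (alpha01 : 0 < alpha < 1) (M0 : 0 < M).
Hypothesis tincr : forall i j, (i < j)%N -> (j <= m)%N -> t i < t j.
Hypothesis rphi : forall n, (n <= m)%N -> regular Omega (phi n).
Hypothesis rmu : forall n, (n < m)%N -> regular Omega (mu n).
Hypothesis gphi : forall j k, (j <= m)%N -> (k <= m)%N ->
  \int[leb R d]_(x in Omega) green (phi j) (phi k) x = 0.
Hypothesis gmu : forall j k, (j < m)%N -> (k < m)%N ->
  \int[leb R d]_(x in Omega) green (mu j) (mu k) x = 0.
Hypothesis hr0 : forall x, Omega x -> r 0%N x = phi 0%N x ^+ 2 - 1 - S.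
Hypothesis hphi : forall n, (n < m)%N -> forall x, Omega x ->
  L1p_caputo alpha t (fun k => phi k x) n.+1 = M * laplacian (mu n) x.
Hypothesis hmu : forall n, (n < m)%N -> forall x, Omega x ->
  mu n x = - eps ^+ 2 * laplacian (midpoint phi n) x
           + (r n.+1 x + S) * midpoint phi n x.
Hypothesis hr : forall n, (n < m)%N -> forall x, Omega x ->
  (r n.+1 x + r n x) / 2 = phi n x ^+ 2 - 1 - S.

Definition density n x : R :=
  eps ^+ 2 / 2 * grad_normsq (phi n) x
  + 1 / 2 * (r n x + S) * (phi n x ^+ 2 - 1 - S) - 1 / 4 * r n x ^+ 2.

Definition incr n x : R := phi n.+1 x - phi n x.

(** Twice the divergence of delta_n grad phi_{n+1/2}, expanded by bilinearity
    into pairs of levels. *)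
Definition flux n x : R :=
  green (phi n.+1) (phi n.+1) x + green (phi n.+1) (phi n) x
  - green (phi n) (phi n.+1) x - green (phi n) (phi n) x.

(** The scheme tested against delta_n, before integration. The relaxation
    equation is used in the form
    r_{n+1}^2 - r_n^2 = 2 (r_{n+1} - r_n) (phi_n^2 - 1 - S). *)
Lemma density_step n x : (n < m)%N -> Omega x ->
  density n.+1 x - density n x = mu n x * incr n x + eps ^+ 2 / 2 * flux n x.
Proof.
move=> nm Ox; rewrite (hmu nm Ox).
have [U [oU OU cU]] := rphi nm; have [V [oV OV cV]] := rphi (ltnW nm).
have -> : laplacian (midpoint phi n) x =
    (laplacian (phi n.+1) x + laplacian (phi n) x) / 2.
  apply: (@laplacian_mean _ _ (U `&` V)); first exact: openI.
  - by apply: C2_onS cU; exact: subIsetl.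
  - by apply: C2_onS cV; exact: subIsetr.
  - by split; [apply: OU|apply: OV]; exact: subset_closure.
have gC : \sum_(i < d) partial i (phi n.+1) x * partial i (phi n) x =
          \sum_(i < d) partial i (phi n) x * partial i (phi n.+1) x.
  by apply: eq_bigr => i _; rewrite mulrC.
have gE k : grad_normsq (phi k) x = \sum_(i < d) partial i (phi k) x * partial i (phi k) x.
  by apply: eq_bigr => i _; rewrite expr2.
rewrite /flux /green gC /density !gE /incr /midpoint.
have -> : r n.+1 x = 2 * (phi n x ^+ 2 - 1 - S) - r n x.
  by rewrite -(hr nm Ox); lra.
move: (\sum_(i < d) partial i (phi n.+1) x * partial i (phi n.+1) x) => A.
move: (\sum_(i < d) partial i (phi n) x * partial i (phi n.+1) x) => B.
move: (\sum_(i < d) partial i (phi n) x * partial i (phi n) x) => C.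
move: (laplacian (phi n.+1) x) (laplacian (phi n) x) => l1 l0.
move: (phi n.+1 x) (phi n x) (r n x) => p1 p0 r0.
by field.
Qed.

Lemma increments_mx x (j : 'I_m) : Omega x ->
  \sum_(k < m) L1p_mx alpha t m j k * incr k x = M * laplacian (mu j) x.
Proof.
move=> Ox; rewrite -hphi// /L1p_caputo big_add1 /= big_mkord.
rewrite (big_ord_widen m (fun k => L1p_coef alpha t j.+1 k.+1 * incr k x))//.
rewrite [RHS]big_mkcond /=; apply: eq_bigr => k _; rewrite mxE ltnS.
by case: ifP => _ //; rewrite mul0r.
Qed.

(** The increments are recovered from the Laplacians of the potentials by
    inverting the L1+ matrix. *)
Lemma increments_invmx x (j : 'I_m) : Omega x ->
  incr j x = \sum_(k < m) invmx (L1p_mx alpha t m) j k * (M * laplacian (mu k) x).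
Proof.
move=> Ox; under eq_bigr do rewrite -(increments_mx _ Ox) mulr_sumr.
rewrite exchange_big /=.
have VB := mulVmx (L1p_mx_unit alpha01 tincr).
rewrite (bigD1 j)//= [X in _ + X]big1 ?addr0 => [|k kj].
  have := congr1 (fun B : 'M[R]_m => B j j) VB; rewrite !mxE eqxx => E.
  under eq_bigr do rewrite mulrA.
  by rewrite -mulr_suml E mul1r.
have := congr1 (fun B : 'M[R]_m => B j k) VB; rewrite !mxE eq_sym (negbTE kj) => E.
under eq_bigr do rewrite mulrA.
by rewrite -mulr_suml E mul0r.
Qed.

Definition total_flux x : R :=
  M * (\sum_(j < m) \sum_(k < m)
        invmx (L1p_mx alpha t m) j k * green (mu j) (mu k) x)
  + eps ^+ 2 / 2 * \sum_(j < m) flux j x.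

(** What separates the two sides is M times the form of the inverse L1+ matrix,
    evaluated at the i-th partial derivatives of the potentials and summed over
    i. *)
Lemma density_le x : Omega x -> density m x <= density 0 x + total_flux x.
Proof.
move=> Ox.
have tel : density m x = density 0 x + \sum_(j < m) (density j.+1 x - density j x).
  by rewrite -(big_mkord xpredT (fun j => density j.+1 x - density j x))
    telescope_sumr// addrC subrK.
rewrite tel lerD2l /total_flux.
under eq_bigr do rewrite (density_step (ltn_ord _) Ox).
rewrite big_split/= -mulr_sumr lerD2r.
set C := invmx _.
have -> : \sum_(j < m) mu j x * incr j x =
  M * \sum_(j < m) \sum_(k < m) C j k * (mu j x * laplacian (mu k) x).
  rewrite mulr_sumr; apply: eq_bigr => j _.
  rewrite (increments_invmx _ Ox) !mulr_sumr; apply: eq_bigr => k _.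
  by rewrite -/C; ring.
rewrite ler_pM2l// -subr_ge0 -sumrB.
have -> : \sum_(j < m) (\sum_(k < m) C j k * green (mu j) (mu k) x -
     \sum_(k < m) C j k * (mu j x * laplacian (mu k) x)) =
  \sum_(i < d) \sum_(j < m) \sum_(k < m)
     C j k * partial i (mu j) x * partial i (mu k) x.
  rewrite exchange_big/=; apply: eq_bigr => j _.
  rewrite exchange_big/= -sumrB; apply: eq_bigr => k _.
  rewrite /green -mulrBr addrK mulr_sumr; apply: eq_bigr => i _.
  by rewrite mulrA.
by apply: sumr_ge0 => i _; exact: invmx_L1p_psd.
Qed.

Lemma total_flux_null : null_integral Omega total_flux.
Proof.
have gP f g : regular Omega f -> regular Omega g ->
    \int[leb R d]_(x in Omega) green f g x = 0 -> null_integral Omega (green f g).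
  by move=> rf rg fg; split => //; exact: integrable_green.
apply: null_integralD => //; apply: null_integralZ => //; apply: null_integral_sum => // j.
  apply: null_integral_sum => // k; apply: null_integralZ => //.
  by apply: gP; [exact: rmu|exact: rmu|exact: gmu].
have h a b : (a <= m)%N -> (b <= m)%N -> null_integral Omega (green (phi a) (phi b)).
  by move=> am bm; apply: gP; [exact: rphi|exact: rphi|exact: gphi].
have N f : null_integral Omega f -> null_integral Omega (fun x => - f x).
  by move=> /(null_integralZ mO (-1)); under eq_fun do rewrite mulN1r.
have jm := ltn_ord j; have jm' := ltnW jm.
rewrite /flux; apply: null_integralD => //; last by apply: N; exact: h.
by apply: null_integralD => //; [apply: null_integralD => //; exact: h|apply: N; exact: h].
Qed.

(** On Omega, r is a polynomial in the earlier phi, by the recursion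
    r_{n+1} = 2 (phi_n^2 - 1 - S) - r_n. *)
Lemma relaxation_cont_closure n : (n <= m)%N -> cont_closure Omega (r n).
Proof.
have sq k : (k <= m)%N -> cont_closure Omega (fun x => phi k x ^+ 2 + cst (- 1 - S) x).
  move=> km; apply: cont_closureD; last exact: cont_closure_cst.
  by apply: cont_closure_sqr; exact/regular_cont_closure/rphi.
elim: n => [_|n IH nm].
  apply: cont_closure_eq (sq 0%N (leq0n _)) => x Ox.
  by rewrite hr0//=; ring.
apply: (cont_closure_eq (g := fun x =>
    cst 2 x * (phi n x ^+ 2 + cst (- 1 - S) x) + - r n x)).
  by move=> x Ox /=; have := hr nm Ox; lra.
apply: cont_closureD; last by apply: cont_closureN; exact: IH (ltnW nm).
by apply: cont_closureM; [exact: cont_closure_cst|exact: sq (ltnW nm)].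
Qed.

Lemma density_integrable n : (n <= m)%N ->
  (leb R d).-integrable Omega (EFin \o density n).
Proof.
move=> nm; apply: cont_closure_integrable => //.
have cr := relaxation_cont_closure nm.
have cp := regular_cont_closure (rphi nm).
apply: cont_closureD; last first.
  apply: cont_closureN; apply: cont_closureM; first exact: cont_closure_cst.
  exact: cont_closure_sqr.
apply: cont_closureD.
  by apply: cont_closureM; [exact: cont_closure_cst|exact/grad_cont_closure/rphi].
apply: cont_closureM.
  apply: cont_closureM; first exact: cont_closure_cst.
  by apply: cont_closureD => //; exact: cont_closure_cst.
apply: cont_closureD; last exact: (cont_closure_cst Omega (- S)).
by apply: cont_closureD; [exact: cont_closure_sqr|exact: (cont_closure_cst Omega (- 1))].
Qed.

Lemma modified_energy_le :
  modified_energy eps S Omega (phi m) (r m) <=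
  modified_energy eps S Omega (phi 0%N) (r 0%N).
Proof.
have [fi f0] := total_flux_null.
have d0 := density_integrable (leq0n m).
rewrite /modified_energy lerD2r -[leRHS]addr0 -f0 -RintegralD//.
apply: le_Rintegral => //; first exact: density_integrable.
  exact: (integrableD mO d0 fi).
exact: density_le.
Qed.

(** With u = phi^2 - 1 and r = u - S, the potential part of the density is
    (u^2 - S^2) / 4, and the constant is compensated by S^2 |Omega| / 4. *)
Lemma modified_energy0 :
  modified_energy eps S Omega (phi 0%N) (r 0%N) = energy eps Omega (phi 0%N).
Proof.
have d0 := density_integrable (leq0n m).
rewrite /modified_energy -(Rintegral_cst (leb R d) mO) -RintegralD//.
  by apply: eq_Rintegral => x /set_mem Ox; rewrite hr0//; field.
apply: cont_closure_integrable => //; exact: cont_closure_cst.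
Qed.

End Dissipation.

(* mu n is mu^{n+1/2}; r is shifted: r n is r^{n-1/2}, so r 0 is r^{-1/2}. *)
Theorem theorem2p1 (R : realType) (d : nat) (hd : (0 < d)%N)
  (alpha eps M S T : R)
  (halpha : 0 < alpha < 1) (heps : 0 < eps) (hM : 0 < M) (hS : 0 <= S)
  (N : nat) (t : nat -> R)
  (ht0 : t 0%N = 0) (htN : t N = T)
  (ht : forall k : nat, (k < N)%N -> t k < t k.+1)
  (Omega : set 'rV[R]_d) (phi mu r : nat -> 'rV[R]_d -> R)
  (hbc :
    (exists a b : 'rV[R]_d,
      [/\ forall i, a 0 i < b 0 i,
          Omega = open_box a b,
          forall n, (n <= N)%N -> periodic_bc a b (phi n)
        & forall n, (n < N)%N -> periodic_bc a b (mu n)])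
    \/
    (exists (sigma : {finite_measure set 'rV[R]_d -> \bar R})
            (nu : 'rV[R]_d -> 'rV[R]_d),
      [/\ bounded_domain Omega,
          finite_perimeter Omega sigma nu,
          forall n, (n <= N)%N -> neumann_bc Omega sigma nu (phi n)
        & forall n, (n < N)%N -> neumann_bc Omega sigma nu (mu n)]))
  (hr0 : forall x, Omega x -> r 0%N x = phi 0%N x ^+ 2 - 1 - S)
  (hphi : forall n, (n < N)%N -> forall x, Omega x ->
    L1p_caputo alpha t (fun k => phi k x) n.+1 = M * laplacian (mu n) x)
  (hmu : forall n, (n < N)%N -> forall x, Omega x ->
    mu n x = - eps ^+ 2 * laplacian (midpoint phi n) x
             + (r n.+1 x + S) * midpoint phi n x)
  (hr : forall n, (n < N)%N -> forall x, Omega x ->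
    (r n.+1 x + r n x) / 2 = phi n x ^+ 2 - 1 - S) :
  forall n, (n < N)%N ->
    modified_energy eps S Omega (phi n.+1) (r n.+1)
      <= modified_energy eps S Omega (phi 0%N) (r 0%N)
    /\ modified_energy eps S Omega (phi 0%N) (r 0%N)
      = energy eps Omega (phi 0%N).

Proof.
have tincr m : (m <= N)%N -> forall i j, (i < j)%N -> (j <= m)%N -> t i < t j.
  move=> mN i j ij jm; have {mN jm} : (j <= N)%N by exact: leq_trans mN.
  elim: j ij => // j IH; rewrite ltnS leq_eqVlt => /predU1P[->|ij] jN; first exact: ht.
  by apply: (lt_trans (IH ij (ltnW jN))); exact: ht.
have [mO bO [rphi rmu] [gphi gmu]] : [/\ measurable Omega, bounded_set Omega,
    (forall n, (n <= N)%N -> regular Omega (phi n)) /\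
    (forall n, (n < N)%N -> regular Omega (mu n)) &
    (forall j k, (j <= N)%N -> (k <= N)%N ->
      \int[leb R d]_(x in Omega) green (phi j) (phi k) x = 0) /\
    (forall j k, (j < N)%N -> (k < N)%N ->
      \int[leb R d]_(x in Omega) green (mu j) (mu k) x = 0)].
  case: hbc => [[a [b [ab -> pphi pmu]]]|[sigma [nu [[oO _ _ bO] fp nphi nmu]]]].
    have reg f : periodic_bc a b f -> regular (open_box a b) f.
      by move=> [cf _]; exists setT; split => //; exact: openT.
    split; [exact: measurable_open_box|exact: bounded_open_box| |].
    - by split => n nN; apply: reg; [exact: pphi|exact: pmu].
    - by split => j k jN kN; apply: integral_green_periodic => //;
        (exact: pphi || exact: pmu).
  have reg f : neumann_bc Omega sigma nu f -> regular Omega f by case.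
  split; [exact: open_measurable_rV|exact: bO| |].
  - by split => n nN; apply: reg; [exact: nphi|exact: nmu].
  - by split => j k jN kN; apply: (integral_green_neumann oO fp);
      (exact: nphi || exact: nmu || (apply: reg; (exact: nphi || exact: nmu))).
move=> n nN.
have le k : (k <= n)%N -> (k < N)%N by move=> kn; exact: leq_ltn_trans nN.
split.
  apply: (modified_energy_le (mu := mu) mO bO halpha hM (tincr _ nN)) => //.
  - by move=> k kn; apply: rphi; exact: leq_trans nN.
  - by move=> k kn; apply: rmu; exact: le.
  - by move=> j k jn kn; apply: gphi; exact: leq_trans nN.
  - by move=> j k jn kn; apply: gmu; exact: le.
  - by move=> k kn x Ox; apply: hphi => //; exact: le.
  - by move=> k kn x Ox; apply: hmu => //; exact: le.
  - by move=> k kn x Ox; apply: hr => //; exact: le.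
apply: (@modified_energy0 _ _ _ mO bO eps S phi r 0) => //.
by move=> k; rewrite leqn0 => /eqP->; exact: rphi.
Qed.
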